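(* Let $(\mathcal{L},\circ_\lambda,[\cdot_\lambda\cdot])$ be a transposed Poisson conformal superalgebra (TPCSA). Then the following identities hold for all (homogeneous) $x,y,z,h,u,v\in\mathcal{L}$: (1) $(-1)^{|x||z|}x\circ_{\lambda}[y_{\mu}z]+(-1)^{|x||y|}y\circ_{\mu}[z_{-\partial-\lambda}x]+(-1)^{|y||z|}z\circ_{-\partial-\lambda-\mu}[x_{\lambda}y]=0$; (2) $(-1)^{|x||z|}[x_{\lambda}y]\circ_{\mu}z+(-1)^{|x||y|}[y_{\mu-\lambda}z]\circ_{-\partial-\lambda}x+(-1)^{|y||z|}[z_{-\partial-\lambda}x]\circ_{-\partial-\mu+\lambda}y=0$; (3) $(-1)^{|x||z|}[(h\circ_{\lambda}[x_{\gamma}y])_{\lambda+\mu}z]+(-1)^{|x||y|}[(h\circ_{\lambda}[y_{\mu-\gamma}z])_{-\partial-\gamma}x]+(-1)^{|y||z|}[(h\circ_{\lambda}[z_{-\partial-\gamma}x])_{-\partial-\mu+\gamma}y]=0$; (4) $(-1)^{|x||z|}[(h\circ_{\lambda}x)_{\lambda+\gamma}[y_{\mu-\gamma}z]]+(-1)^{|x||y|}[(h\circ_{\lambda}y)_{\lambda+\mu-\gamma}[z_{-\partial-\gamma}x]]+(-1)^{|y||z|}[(h\circ_{\lambda}z)_{-\partial-\mu}[x_{\gamma}y]]=0$; (5) $(-1)^{|x||z|}[h_{\lambda}x]\circ_{\lambda+\gamma}[y_{\mu-\gamma}z]+(-1)^{|x||y|}[h_{\lambda}y]\circ_{\lambda+\mu-\gamma}[z_{-\partial-\gamma}x]+(-1)^{|y||z|}[h_{\lambda}z]\circ_{-\partial-\mu}[x_{\gamma}y]=0$;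 (6) $(-1)^{|v||x|}[(u\circ_{\lambda}x)_{\mu}(v\circ_{\gamma}y)]+(-1)^{|u|(|x|+|v|)}[(v\circ_{\gamma}x)_{\gamma+\mu-\lambda}(u\circ_{\lambda}y)]=2(u\circ_{\lambda}v)\circ_{\lambda+\gamma}[x_{\mu-\lambda}y]$; (7) $(-1)^{|v||x|}x\circ_{\mu-\lambda}[u_{\lambda}(v\circ_{\gamma}y)]+(-1)^{|u||v|}[(v\circ_{\gamma}x)_{\gamma+\mu-\lambda}u]\circ_{\gamma+\mu}y-(-1)^{|u||x|}(u\circ_{\lambda}v)\circ_{\lambda+\gamma}[x_{\mu-\lambda}y]=0$.
   Context: All vector spaces and linear maps are over $\mathbb{C}$. A $\mathbb{Z}_2$-graded $\mathbb{C}[\partial]$-module is a $\mathbb{C}[\partial]$-module $A=A_{\bar0}\oplus A_{\bar1}$ with $\partial A_i\subseteq A_i$; $|a|$ denotes the parity of a homogeneous element $a$. Whenever $|a|$ occurs, $a$ is assumed homogeneous, and the formula is extended by linearity. $A[\lambda]$ denotes polynomials in $\lambda$ with coefficients in $A$. A conformal superalgebra $(A,\circ_\lambda)$ is a $\mathbb{Z}_2$-graded $\mathbb{C}[\partial]$-module $A$ with a $\mathbb{C}$-bilinear map $A\otimes A\to A[\lambda]$, $a\otimes b\mapsto a\circ_\lambda b$, with $A_i\circ_\lambda A_j\subseteq A_{i+j}[\lambda]$, satisfying sesquilinearity: $(\partial a)\circ_\lambda b=-\lambda\, a\circ_\lambda b$, $a\circ_\lambda(\partial b)=(\partial+\lambda)(a\circ_\lambda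 b)$. Substitution convention: if $a\circ_\lambda b=\sum_n\lambda^n c_n$, then $a\circ_{-\partial-\lambda}b=\sum_n(-\partial-\lambda)^nc_n$ with $\partial$ acting on the coefficients $c_n$, and similarly for other subscripts involving $\partial$ and for brackets; in nested expressions, a $\partial$ in a subscript acts on the result of the product or bracket of which it is the subscript. Products are extended polynomially in the other formal variables. It is commutative if $a\circ_\lambda b=(-1)^{|a||b|}b\circ_{-\partial-\lambda}a$, and associative if $a\circ_\lambda(b\circ_\mu c)=(a\circ_\lambda b)\circ_{\lambda+\mu}c$, for all $a,b,c$. A Lie conformal superalgebra $(A,[\cdot_\lambda\cdot])$ is a $\mathbb{Z}_2$-graded $\mathbb{C}[\partial]$-module with a $\mathbb{C}$-bilinear map $a\otimes b\mapsto[a_\lambda b]\in A[\lambda]$, $[{A_i}_\lambda A_j]\subseteq A_{i+j}[\lambda]$, such that $[(\partial a)_\lambda b]=-\lambda[a_\lambda b]$, $[a_\lambda(\partial b)]=(\partial+\lambda)[a_\lambda b]$, $[a_\lambda b]=-(-1)^{|a||b|}[b_{-\lambda-\partial}a]$, and $[a_\lambda[b_\mu c]]=[[a_\lambda b]_{\lambda+\mu}c]+(-1)^{|a||b|}[b_\mu[a_\lambda c]]$. A transposed Poisson conformal superalgebra (TPCSA) is a $\mathbb{Z}_2$-graded $\mathbb{C}[\partial]$-module $\mathcal{L}$ with $\circ_\lambda$ and $[\cdot_\lambda\cdot]$ such that $(\mathcal{L},\circ_\lambda)$ is a commutative associative conformal superalgebra, $(\mathcal{L},[\cdot_\lambda\cdot])$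 is a Lie conformal superalgebra, and $2(a\circ_\lambda[b_\mu c])=[(a\circ_\lambda b)_{\lambda+\mu}c]+(-1)^{|a||b|}[b_\mu(a\circ_\lambda c)]$ for all $a,b,c\in\mathcal{L}$. *)

(* Defs.v *)
From HB Require Import structures.
From mathcomp Require Import all_boot all_order all_algebra.
From mathcomp Require Import reals complex.
From mathcomp Require Import finmap monalg.

Set Implicit Arguments.
Unset Strict Implicit.
Unset Printing Implicit Defensive.

Import GRing.Theory.
Local Open Scope ring_scope.

(* The scalars are C = R[i] for R : realType.  Parities are booleans: false is
   0 mod 2, true is 1 mod 2, and (+) is their sum. *)

Record gradedModule (R : realType) := GradedModule {
  carrier :> lmodType R[i];
  deriv : {linear carrier -> carrier};
  homog : bool -> {pred carrier};
  homog_submod : forall i, submod_closed (homog i);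
  homog_deriv : forall i a, a \in homog i -> deriv a \in homog i;
  homog_span : forall a, exists a0 a1,
    [/\ a0 \in homog false, a1 \in homog true & a = a0 + a1];
  homog_direct : forall a, a \in homog false -> a \in homog true -> a = 0
}.
Arguments homog {R} g i.

(* fpoly V is V[lambda, mu, gamma]: finitely supported families of coefficients
   in V, the index (i, j, k) standing for lambda^i mu^j gamma^k. *)
Definition expo : choiceType := (nat * nat * nat)%type.

Definition addexpo (m n : expo) : expo :=
  (m.1.1 + n.1.1, m.1.2 + n.1.2, m.2 + n.2)%N.

Definition fpoly (V : zmodType) : zmodType := {malg V[expo]}.

Section FormalPolynomials.
Variable V : zmodType.
Implicit Types (p q : fpoly V) (s : fpoly V -> fpoly V).

Definition fconst (a : V) : fpoly V := << a *g (0, 0, 0)%N >>.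

Definition mulmon (m : expo) p : fpoly V :=
  \sum_(k <- msupp p) << p@_k *g addexpo m k >>.

Definition lam : fpoly V -> fpoly V := mulmon (1, 0, 0)%N.
Definition mu  : fpoly V -> fpoly V := mulmon (0, 1, 0)%N.
Definition gam : fpoly V -> fpoly V := mulmon (0, 0, 1)%N.

Definition mapcoef (f : V -> V) p : fpoly V :=
  \sum_(k <- msupp p) << f p@_k *g k >>.

(* An element of C[d, lambda, mu, gamma], d the derivation, is represented by
   the operator through which it acts on fpoly V; pointwise \+, \- are its sums
   and opposites.  If f a b = \sum_k lambda^k c_k, then the product of the
   constants a and b with subscript s is \sum_k s^k c_k, so that a derivation
   in s acts on the result of the product; lprod extends this polynomially in
   lambda, mu, gamma. *)
Definition lprod (f : V -> V -> {malg V[nat]}) s p q : fpoly V :=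
  \sum_(m <- msupp p) \sum_(n <- msupp q)
    mulmon (addexpo m n)
      (\sum_(k <- msupp (f p@_m q@_n)) iter k s (fconst (f p@_m q@_n)@_k)).

End FormalPolynomials.
Arguments lam {V}.
Arguments mu {V}.
Arguments gam {V}.

Notation "a %:FP" := (fconst a)
  (at level 2, left associativity, format "a %:FP") : ring_scope.

Definition D {R : realType} {L : gradedModule R} : fpoly L -> fpoly L :=
  mapcoef (@deriv R L).

Section Products.
Variables (R : realType) (L : gradedModule R) (f : L -> L -> {malg L[nat]}).

Local Notation "p ∘_[ s ] q" := (lprod f s p q)
  (at level 40, s at level 200, left associativity).

Definition conformal_product : Prop :=
  [/\ forall (n : nat) (b : L), linear (fun a : L => (f a b)@_n),
      forall (n : nat) (a : L), linear (fun b : L => (f a b)@_n),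
      forall (i j : bool) (a b : L) (n : nat),
        a \in homog L i -> b \in homog L j -> (f a b)@_n \in homog L (i (+) j),
      forall a b : L,
        (deriv L a)%:FP ∘_[lam] b%:FP = - lam (a%:FP ∘_[lam] b%:FP)
    & forall a b : L,
        a%:FP ∘_[lam] (deriv L b)%:FP = (D \+ lam) (a%:FP ∘_[lam] b%:FP)].

Definition conformal_commutative : Prop :=
  forall (i j : bool) (a b : L), a \in homog L i -> b \in homog L j ->
    a%:FP ∘_[lam] b%:FP
    = (b%:FP ∘_[\- D \- lam] a%:FP) *~ (-1) ^+ (i * j).

Definition conformal_associative : Prop :=
  forall a b c : L,
    a%:FP ∘_[lam] (b%:FP ∘_[mu] c%:FP)
    = (a%:FP ∘_[lam] b%:FP) ∘_[lam \+ mu] c%:FP.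

Definition conformal_skew : Prop :=
  forall (i j : bool) (a b : L), a \in homog L i -> b \in homog L j ->
    a%:FP ∘_[lam] b%:FP
    = - ((b%:FP ∘_[\- lam \- D] a%:FP) *~ (-1) ^+ (i * j)).

Definition conformal_jacobi : Prop :=
  forall (i j : bool) (a b c : L), a \in homog L i -> b \in homog L j ->
    a%:FP ∘_[lam] (b%:FP ∘_[mu] c%:FP)
    = (a%:FP ∘_[lam] b%:FP) ∘_[lam \+ mu] c%:FP
      + (b%:FP ∘_[mu] (a%:FP ∘_[lam] c%:FP)) *~ (-1) ^+ (i * j).

End Products.

Definition comm_assoc_conformal_superalgebra (R : realType)
    (L : gradedModule R) (f : L -> L -> {malg L[nat]}) : Prop :=
  [/\ conformal_product f, conformal_commutative f & conformal_associative f].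

Definition lie_conformal_superalgebra (R : realType)
    (L : gradedModule R) (f : L -> L -> {malg L[nat]}) : Prop :=
  [/\ conformal_product f, conformal_skew f & conformal_jacobi f].

Definition transposed_leibniz (R : realType) (L : gradedModule R)
    (f g : L -> L -> {malg L[nat]}) : Prop :=
  forall (i j : bool) (a b c : L), a \in homog L i -> b \in homog L j ->
    lprod f lam a%:FP (lprod g mu b%:FP c%:FP) *+ 2
    = lprod g (lam \+ mu) (lprod f lam a%:FP b%:FP) c%:FP
      + lprod g mu b%:FP (lprod f lam a%:FP c%:FP) *~ (-1) ^+ (i * j).

Record TPCSA (R : realType) := MkTPCSA {
  tpcsa_module :> gradedModule R;
  tpcsa_circ : tpcsa_module -> tpcsa_module -> {malg tpcsa_module[nat]};
  tpcsa_brk : tpcsa_module -> tpcsa_module -> {malg tpcsa_module[nat]};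
  tpcsa_circP : comm_assoc_conformal_superalgebra tpcsa_circ;
  tpcsa_brkP : lie_conformal_superalgebra tpcsa_brk;
  tpcsa_leibniz : transposed_leibniz tpcsa_circ tpcsa_brk
}.

Notation "p ∘_[ s ] q" := (lprod (@tpcsa_circ _ _) s p q)
  (at level 40, s at level 200, left associativity,
   format "p  ∘_[ s ]  q") : ring_scope.
Notation "⟦ p ,_[ s ] q ⟧" := (lprod (@tpcsa_brk _ _) s p q)
  (at level 0, p at level 200, s at level 200, q at level 200,
   format "⟦ p  ,_[ s ]  q ⟧") : ring_scope.

(* Main.v *)
Require Import Defs.
From HB Require Import structures.
From mathcomp Require Import all_boot all_order all_algebra.
From mathcomp Require Import reals complex.
From mathcomp Require Import finmap monalg.

Set Implicit Arguments.
Unset Strict Implicit.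
Unset Printing Implicit Defensive.

Import GRing.Theory.
Local Open Scope ring_scope.

(* Give every argument of a product a formal weight, the last one having the
   weight making the total equal to - D.  Commutativity and skew-symmetry then
   move the argument without a free weight to the far right, and in this form
   all axioms involve subscripts in lambda, mu, gamma only; the one new rule is
   the Leibniz rule with that argument outside the bracket, obtained by
   substituting a D-dependent subscript for lambda.  What remains is the algebra
   of ordinary transposed Poisson superalgebras:
   - x[y,z] - y[x,z] + [x,y]z = 0 follows by adding three Leibniz rules;
   - with S3, S4 the sums in (3), (4): the Leibniz rule for h times the Jacobi
     identity gives S3 = S4, while expanding 2 h[x,y] inside S3 and using the
     Jacobi identity gives 2 S3 = S4, so both vanish; (5) reduces to (3) by (1);
   - (6) is half the sum of four Leibniz rules, and (7) follows from (1). *)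

(** * Formal polynomials *)

Section CoefficientSums.
Variables (K : choiceType) (V W : zmodType).
Implicit Types (p q : {malg V[K]}) (F : K -> V -> W).

(** Additivity is kept as a bare predicate so that it applies to partially applied products and ad
    hoc functions. Compatibility with subtraction alone yields zero, opposites and sums. *)
Definition diffmorph (A B : zmodType) (f : A -> B) :=
  forall x y : A, f (x - y) = f x - f y.

Lemma diffmorph0 (A B : zmodType) (f : A -> B) : diffmorph f -> f 0 = 0.
Proof. by move=> fB; rewrite -[X in f X](subrr 0) fB subrr. Qed.

Lemma diffmorphN (A B : zmodType) (f : A -> B) :
  diffmorph f -> forall x, f (- x) = - f x.
Proof. by move=> fB x; rewrite -[- x]add0r fB (diffmorph0 fB) add0r. Qed.

Lemma diffmorphD (A B : zmodType) (f : A -> B) :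
  diffmorph f -> forall x y, f (x + y) = f x + f y.
Proof. by move=> fB x y; rewrite -[y in LHS]opprK fB (diffmorphN fB) opprK. Qed.

Lemma diffmorph_sum (A B : zmodType) (f : A -> B) (I : Type) (r : seq I)
    (P : pred I) (E : I -> A) :
  diffmorph f -> f (\sum_(i <- r | P i) E i) = \sum_(i <- r | P i) f (E i).
Proof.
by move=> fB; apply: big_morph; [apply: diffmorphD|apply: diffmorph0].
Qed.

Lemma diffmorphMz (A B : zmodType) (f : A -> B) :
  diffmorph f -> forall x n, f (x *~ n) = f x *~ n.
Proof.
move=> fB x; have fMn n : f (x *+ n) = f x *+ n.
  by elim: n => [|n IH]; rewrite ?mulr0n ?diffmorph0 // !mulrS diffmorphD ?IH.
by case=> n; rewrite ?NegzE ?mulrNz ?diffmorphN // -?pmulrn fMn.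
Qed.

(** Indices outside the support contribute [F k 0 = 0]; this allows sums attached to different
    polynomials to be put on a common index set. *)
Lemma msupp_sumw F (A : {fset K}) p :
  (forall k, F k 0 = 0) -> (msupp p `<=` A)%fset ->
  \sum_(k <- msupp p) F k p@_k = \sum_(k <- A) F k p@_k.
Proof.
move=> F0 pA; apply: big_fset_incl => // k _ /mcoeff_outdom ->; exact: F0.
Qed.

Lemma msupp_sumB F : (forall k, diffmorph (F k)) ->
  diffmorph (fun p => \sum_(k <- msupp p) F k p@_k).
Proof.
move=> FB p q; have F0 k : F k 0 = 0 by apply: diffmorph0.
pose A := (msupp p `|` msupp q)%fset.
rewrite (@msupp_sumw F A) ?msuppB_le // (@msupp_sumw F A p) ?fsubsetUl //.
rewrite (@msupp_sumw F A q) ?fsubsetUr // -sumrB.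
by apply: eq_bigr => k _; rewrite mcoeffB FB.
Qed.

Lemma msupp_sumU F a k : (forall k, F k 0 = 0) ->
  \sum_(i <- msupp << a *g k >>) F i << a *g k >>@_i = F k a.
Proof.
move=> F0; rewrite (@msupp_sumw F [fset k]%fset) ?msuppU_le //.
by rewrite big_seq_fset1 mcoeffUU.
Qed.

(** Every polynomial is the sum of its monomials. The predicate [A] can be a parity component, since
    sign rules are available on homogeneous coefficients only. *)
Lemma malg_ext (A : {pred V}) (f g : {malg V[K]} -> W) :
  diffmorph f -> diffmorph g ->
  (forall k a, a \in A -> f << a *g k >> = g << a *g k >>) ->
  forall p, (forall k, p@_k \in A) -> f p = g p.
Proof.
move=> fB gB fg p pA; rewrite (monalgE p) !diffmorph_sum //.
by apply: eq_bigr => k _; apply: fg.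
Qed.

End CoefficientSums.

(** * Multiplication by monomials, polynomial linearity and substitution *)

Section Monomials.
Variable V : zmodType.
Implicit Types (p q : fpoly V) (m n : expo) (s t : fpoly V -> fpoly V).

Lemma addexpoA : associative addexpo.
Proof. by move=> m n k; rewrite /addexpo /= !addnA. Qed.

Lemma addexpoC : commutative addexpo.
Proof. by move=> m n; congr (_, _, _); rewrite /= addnC. Qed.

Lemma addexpoAC m n k : addexpo m (addexpo n k) = addexpo n (addexpo m k).
Proof. by rewrite !addexpoA (addexpoC m). Qed.

Lemma addexpom0 m : addexpo m (0, 0, 0)%N = m.
Proof. by case: m => -[i j] k; rewrite /addexpo /= !addn0. Qed.

Lemma monalgU_diff (K : choiceType) (k : K) :
  diffmorph (fun a : V => << a *g k >>).
Proof. by move=> a b; rewrite monalgUB. Qed.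

Lemma mulmonB m : diffmorph (@mulmon V m).
Proof.
apply: (msupp_sumB (F := fun k a => << a *g addexpo m k >>)) => k.
exact: monalgU_diff.
Qed.

Lemma mulmonU m a k : mulmon m << a *g k >> = << a *g addexpo m k >> :> fpoly V.
Proof.
rewrite /mulmon (msupp_sumU (F := fun k a => << a *g addexpo m k >>)) // => i.
exact: monalgU0.
Qed.

Lemma mulmonA m n p : mulmon m (mulmon n p) = mulmon (addexpo m n) p.
Proof.
apply: (@malg_ext _ _ _ predT (fun p => mulmon m (mulmon n p))
                  (mulmon (addexpo m n))) => // [a b|a b|k a _];
  rewrite ?mulmonB //.
by rewrite !mulmonU addexpoA.
Qed.

Lemma monomialE a k : << a *g k >> = mulmon k a%:FP :> fpoly V.
Proof. by rewrite /fconst mulmonU addexpom0. Qed.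

Lemma fconstB : diffmorph (@fconst V).
Proof. exact: monalgU_diff. Qed.

Lemma iterB s (n : nat) : diffmorph s -> diffmorph (iter n s).
Proof. by move=> sB; elim: n => [|n IH] p q //; rewrite !iterS IH sB. Qed.

(** Linearity over $\mathbb{Z}[\lambda,\mu,\gamma]$. Through [plinear_ext] it reduces identities
    between polynomials to constants, for which the axioms are stated. *)
Definition plinear (F : fpoly V -> fpoly V) :=
  diffmorph F /\ forall m p, F (mulmon m p) = mulmon m (F p).

Lemma plinear_ext (A : {pred V}) F G : plinear F -> plinear G ->
  (forall a, a \in A -> F a%:FP = G a%:FP) ->
  forall p, (forall k, p@_k \in A) -> F p = G p.
Proof.
move=> [FB Fm] [GB Gm] FG; apply: malg_ext => // k a aA.
by rewrite monomialE Fm Gm FG.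
Qed.

Lemma plinear_id : plinear (fun p => p).
Proof. by []. Qed.

Lemma plinear_comp F G : plinear F -> plinear G -> plinear (fun p => F (G p)).
Proof.
by move=> [FB Fm] [GB Gm]; split=> [p q|m p]; rewrite ?GB ?FB ?Gm ?Fm.
Qed.

Lemma plinear_mulmon m : plinear (mulmon m).
Proof.
by split=> [|n p]; [apply: mulmonB|rewrite !mulmonA addexpoC].
Qed.

Lemma plinearD F G : plinear F -> plinear G -> plinear (fun p => F p + G p).
Proof.
move=> [FB Fm] [GB Gm]; split=> [p q|m p]; first by rewrite FB GB opprD addrACA.
by rewrite Fm Gm diffmorphD //; apply: mulmonB.
Qed.

Lemma plinearN F : plinear F -> plinear (fun p => - F p).
Proof.
move=> [FB Fm]; split=> [p q|m p]; first by rewrite FB opprB opprK addrC.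
by rewrite Fm diffmorphN //; apply: mulmonB.
Qed.

Lemma plinearMz F (n : int) : plinear F -> plinear (fun p => F p *~ n).
Proof.
move=> [FB Fm]; split=> [p q|m p]; first by rewrite FB mulrzBl.
by rewrite Fm diffmorphMz //; apply: mulmonB.
Qed.

Lemma plinearMn F (n : nat) : plinear F -> plinear (fun p => F p *+ n).
Proof.
move=> /(@plinearMz _ n%:Z) [FB Fm].
by split=> [p q|m p]; [have := FB p q|have := Fm m p]; rewrite -!pmulrn.
Qed.

Lemma plinearB F G : plinear F -> plinear G -> plinear (fun p => F p - G p).
Proof. by move=> lF lG; apply: plinearD => //; apply: plinearN. Qed.

(** This is the inner sum of [lprod]: a product [P], seen as a polynomial in $\lambda$, evaluated at
    $\lambda := s$, with iterates of the operator as powers. *)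
Definition evalp s (P : {malg V[nat]}) : fpoly V :=
  \sum_(k <- msupp P) iter k s (P@_k)%:FP.

Lemma evalpB s : diffmorph s -> diffmorph (evalp s).
Proof.
move=> sB; rewrite /evalp.
apply: (msupp_sumB (F := fun (k : nat) (a : V) => iter k s a%:FP)) => k a b.
by rewrite fconstB iterB.
Qed.

(* Two substitutions into the same product agree as soon as they agree on
   constants and intertwine multiplication by the formal variable with the same
   operator. *)
Lemma evalp_move (W : zmodType) (F G : fpoly V -> W) (s t : fpoly V -> fpoly V)
    (w : W -> W) (P : {malg V[nat]}) :
  diffmorph F -> diffmorph G ->
  (forall p, F (s p) = w (F p)) -> (forall p, G (t p) = w (G p)) ->
  (forall k, F (P@_k)%:FP = G (P@_k)%:FP) -> F (evalp s P) = G (evalp t P).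
Proof.
move=> FB GB Fs Gt FG; rewrite !diffmorph_sum //; apply: eq_bigr => k _.
have iE (H : fpoly V -> W) u : (forall p, H (u p) = w (H p)) ->
    forall (n : nat) p, H (iter n u p) = iter n w (H p).
  by move=> Hu; elim=> //= n IH p; rewrite Hu IH.
by rewrite (iE F) // (iE G) // FG.
Qed.

Lemma eq_evalp s t P : s =1 t -> evalp s P = evalp t P.
Proof. by move=> st; apply: eq_bigr => k _; apply: eq_iter. Qed.

Lemma eq_lprod f s t p q : s =1 t -> lprod f s p q = lprod f t p q.
Proof.
move=> st; apply: eq_bigr => m _; apply: eq_bigr => n _; congr mulmon.
exact: eq_evalp.
Qed.

(* The substitution lambda := s, mu := t; the variable gamma is set to 1. *)
Definition subst s t p : fpoly V :=
  \sum_(m <- msupp p) iter m.1.1 s (iter m.1.2 t (p@_m)%:FP).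

Section Subst.
Variables s t : fpoly V -> fpoly V.
Hypotheses (sB : diffmorph s) (tB : diffmorph t).

Lemma subst_monoB (m : expo) :
  diffmorph (fun a => iter m.1.1 s (iter m.1.2 t a%:FP)).
Proof. by move=> a b; rewrite fconstB !iterB. Qed.

Lemma substB : diffmorph (subst s t).
Proof.
rewrite /subst.
apply: (msupp_sumB (F := fun (m : expo) a => iter m.1.1 s (iter m.1.2 t a%:FP))).
exact: subst_monoB.
Qed.

Lemma substU a k : subst s t << a *g k >> = iter k.1.1 s (iter k.1.2 t a%:FP).
Proof.
rewrite /subst (msupp_sumU (F := fun m a => iter m.1.1 s (iter m.1.2 t a%:FP))) //.
by move=> m; rewrite (diffmorph0 (subst_monoB m)).
Qed.

Lemma subst_const a : subst s t a%:FP = a%:FP.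
Proof. exact: substU. Qed.

Lemma subst_lam p : subst s t (lam p) = s (subst s t p).
Proof.
apply: (@malg_ext _ _ _ predT (fun p => subst s t (lam p))
                  (fun p => s (subst s t p))) => // [a b|a b|k a _].
- by rewrite [lam _]mulmonB substB.
- by rewrite substB sB.
- by rewrite /lam mulmonU !substU.
Qed.

Lemma subst_mu p : (forall q, s (t q) = t (s q)) ->
  subst s t (mu p) = t (subst s t p).
Proof.
move=> st.
apply: (@malg_ext _ _ _ predT (fun p => subst s t (mu p))
                  (fun p => t (subst s t p))) => // [a b|a b|k a _].
- by rewrite [mu _]mulmonB substB.
- by rewrite substB tB.
(* The powers of [s] are applied outermost, so [t] has to be moved past each of them. *)
rewrite /mu mulmonU !substU /=; elim: (k.1.1) => //= i ->; exact: st.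
Qed.

End Subst.

End Monomials.

(** * Identities in abelian groups *)

Section AbelianIdentities.
Variable V : zmodType.

Inductive zexpr :=
  | ZVar of nat | ZZero | ZAdd of zexpr & zexpr | ZOpp of zexpr
  | ZMul of zexpr & int.

Fixpoint zeval (l : seq V) e : V :=
  match e with
  | ZVar n => nth 0 l n
  | ZZero => 0
  | ZAdd e1 e2 => zeval l e1 + zeval l e2
  | ZOpp e1 => - zeval l e1
  | ZMul e1 c => zeval l e1 *~ c
  end.

Fixpoint zcoef e (i : nat) : int :=
  match e with
  | ZVar n => (n == i)%:Z
  | ZZero => 0
  | ZAdd e1 e2 => zcoef e1 i + zcoef e2 i
  | ZOpp e1 => - zcoef e1 i
  | ZMul e1 c => zcoef e1 i * c
  end.

Fixpoint zbound e N : bool :=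
  match e with
  | ZVar n => (n < N)%N
  | ZZero => true
  | ZAdd e1 e2 => zbound e1 N && zbound e2 N
  | ZOpp e1 => zbound e1 N
  | ZMul e1 _ => zbound e1 N
  end.

(** Normal form: the coefficient vector determines the value, so equality can be decided by
    comparing integers. The bound keeps every atom within the range of summation. *)
Lemma zevalE l N e : zbound e N ->
  zeval l e = \sum_(0 <= i < N) nth 0 l i *~ zcoef e i.
Proof.
elim: e => /= [n nN||e1 IH1 e2 IH2 /andP[b1 b2]|e IH b|e IH c b].
- rewrite big_mkord (bigD1 (Ordinal nN)) //= eqxx mulr1z big1 ?addr0 // => i.
  by rewrite -val_eqE /= eq_sym => /negbTE ->; rewrite mulr0z.
- by rewrite big1 // => i _; rewrite mulr0z.
- by rewrite IH1 // IH2 // -big_split; apply: eq_bigr => i _; rewrite mulrzDr.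
- by rewrite IH // -sumrN; apply: eq_bigr => i _; rewrite mulrNz.
- rewrite IH // (diffmorph_sum (f := fun x => x *~ c)) => [|x y].
    by apply: eq_bigr => i _; rewrite mulrzA.
  exact: mulrzBl.
Qed.

Lemma zexpr_eq l N e1 e2 :
  [&& zbound e1 N, zbound e2 N &
      all (fun i => zcoef e1 i == zcoef e2 i) (iota 0 N)] ->
  zeval l e1 = zeval l e2.
Proof.
case/and3P=> b1 b2 /allP e12; rewrite !(@zevalE l N) //.
by apply: eq_big_nat => i iN; rewrite (eqP (e12 i _)) // mem_iota.
Qed.

End AbelianIdentities.

Ltac zmem x l :=
  lazymatch l with
  | nil => constr:(false)
  | x :: _ => constr:(true)
  | _ :: ?l' => zmem x l'
  end.

Ltac zindex x l :=
  lazymatch l with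
  | x :: _ => constr:(O)
  | _ :: ?l' => let n := zindex x l' in constr:(S n)
  end.

Ltac zatoms e l :=
  lazymatch e with
  | (?a + ?b)%R => let l := zatoms a l in zatoms b l
  | (- ?a)%R => zatoms a l
  | (?a *~ ?c)%R => zatoms a l
  | (?a *+ ?c)%R => zatoms a l
  | 0%R => l
  | _ => lazymatch zmem e l with
         | true => l
         | false => constr:(e :: l)
         end
  end.

Ltac zreify e l :=
  lazymatch e with
  | (?a + ?b)%R =>
      let ea := zreify a l in let eb := zreify b l in constr:(ZAdd ea eb)
  | (- ?a)%R => let ea := zreify a l in constr:(ZOpp ea)
  | (?a *~ ?c)%R => let ea := zreify a l in constr:(ZMul ea c)
  | (?a *+ ?c)%R => let ea := zreify a l in constr:(ZMul ea (Posz c))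
  | 0%R => constr:(ZZero)
  | _ => let n := zindex e l in constr:(ZVar n)
  end.

(* Decides identities between integral combinations of elements of a zmodType,
   the integers being closed terms. *)
Ltac zmod :=
  lazymatch goal with
  | |- @eq ?T ?a ?b =>
      let l := zatoms a (@nil T) in
      let l := zatoms b l in
      let N := eval lazy in (size l) in
      let ea := zreify a l in
      let eb := zreify b l in
      refine (@zexpr_eq _ l N ea eb _); vm_compute; reflexivity
  end.

(** * Subscripts and lambda-products *)

Section Subscripts.
Variables (R : realType) (L : gradedModule R).
Implicit Types (p q r : fpoly L) (s t w : fpoly L -> fpoly L) (i j : bool).

Lemma homog0 i : 0 \in homog L i.
Proof. by case: (@homog_submod R L i). Qed.

Lemma homogB i (a b : L) : a \in homog L i -> b \in homog L i ->
  a - b \in homog L i.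
Proof.
move=> ha hb; case: (@homog_submod R L i) => _ /(_ (-1) b a hb ha).
by rewrite scaleN1r addrC.
Qed.

Definition phomog i p := forall k, p@_k \in homog L i.

Lemma phomogB i p q : phomog i p -> phomog i q -> phomog i (p - q).
Proof. by move=> hp hq k; rewrite mcoeffB homogB. Qed.

Lemma phomog0 i : phomog i 0.
Proof. by move=> k; rewrite mcoeff0 homog0. Qed.

Lemma phomogN i p : phomog i p -> phomog i (- p).
Proof. by move=> hp; rewrite -sub0r; apply: phomogB => //; apply: phomog0. Qed.

Lemma phomogD i p q : phomog i p -> phomog i q -> phomog i (p + q).
Proof. by move=> hp /phomogN; rewrite -[q in p + q]opprK; apply: phomogB. Qed.

Lemma phomog_sum i (I : Type) (r : seq I) (E : I -> fpoly L) :
  (forall k, phomog i (E k)) -> phomog i (\sum_(k <- r) E k).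
Proof.
by move=> hE; elim/big_rec: _ => [|k p _]; [apply: phomog0|apply: phomogD].
Qed.

Lemma phomogU i a (k : expo) : a \in homog L i -> phomog i << a *g k >>.
Proof. by move=> ha n; rewrite mcoeffU; case: eqP; rewrite ?mulr0n ?homog0. Qed.

Lemma phomog_mulmon i m p : phomog i p -> phomog i (mulmon m p).
Proof. by move=> hp; apply: phomog_sum => k; apply: phomogU. Qed.

Lemma DU a (k : expo) : D << a *g k >> = << Defs.deriv L a *g k >>.
Proof.
rewrite /D /mapcoef (msupp_sumU (F := fun k a => << Defs.deriv L a *g k >>)) // => i.
by rewrite linear0 monalgU0.
Qed.

Lemma plinear_D : plinear (@D R L).
Proof.
have DB : diffmorph (@D R L).
  rewrite /D /mapcoef.
  apply: (msupp_sumB (F := fun (k : expo) a => << Defs.deriv L a *g k >>)) => k a b.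
  by rewrite linearB monalgUB.
split=> // m p; apply: (@malg_ext _ _ _ predT (fun p => D (mulmon m p))
   (fun p => mulmon m (D p))) => // [a b|a b|k a _].
- by rewrite mulmonB DB.
- by rewrite DB mulmonB.
- by rewrite mulmonU !DU mulmonU.
Qed.

Lemma D_const a : D a%:FP = (Defs.deriv L a)%:FP.
Proof. exact: DU. Qed.

(** Models the elements of $\mathbb{Z}[\partial,\lambda,\mu,\gamma]$. Commuting with [D] lets
    substitutions pass through $\partial$; preserving parity keeps products homogeneous. *)
Record subscript s : Prop := Subscript {
  subscript_plinear : plinear s;
  subscriptD : forall p, s (D p) = D (s p);
  subscript_homog : forall i p, phomog i p -> phomog i (s p)
}.

(* Centrality holds for multiplication by elements of Z[lambda, mu, gamma] and
   can fail for D, so that weights are the subscripts not involving D. *)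
Record weight t : Prop := Weight {
  weight_plinear : plinear t;
  weight_central : forall F, plinear F -> forall p, F (t p) = t (F p);
  weight_homog : forall i p, phomog i p -> phomog i (t p)
}.

Lemma weight_mulmon m : weight (mulmon m).
Proof.
split; [exact: plinear_mulmon| |by move=> i p; apply: phomog_mulmon].
by move=> F [_ Fm] p; rewrite Fm.
Qed.

Lemma weight_lam : weight lam. Proof. exact: weight_mulmon. Qed.
Lemma weight_mu : weight mu. Proof. exact: weight_mulmon. Qed.
Lemma weight_gam : weight gam. Proof. exact: weight_mulmon. Qed.

Lemma weightD s t : weight s -> weight t -> weight (s \+ t).
Proof.
move=> [ls cs hs] [lt ct ht]; split=> [|F lF p|i p hp] /=.
- exact: (plinearD ls lt).
- by case: (lF) => FB _; rewrite (diffmorphD FB) (cs _ lF) (ct _ lF).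
- by apply: phomogD; [apply: hs|apply: ht].
Qed.

Lemma weightB s t : weight s -> weight t -> weight (s \- t).
Proof.
move=> [ls cs hs] [lt ct ht]; split=> [|F lF p|i p hp] /=.
- exact: (plinearB ls lt).
- by case: (lF) => FB _; rewrite FB (cs _ lF) (ct _ lF).
- by apply: phomogB; [apply: hs|apply: ht].
Qed.

Lemma weight_subscript s : weight s -> subscript s.
Proof. by case=> ls cs hs; split=> // p; rewrite cs //; apply: plinear_D. Qed.

Lemma subscript_D : subscript D.
Proof.
split=> [|//|i p hp]; first exact: plinear_D.
by apply: phomog_sum => k; apply/phomogU/homog_deriv/hp.
Qed.

Lemma subscriptN s : subscript s -> subscript (\- s).
Proof.
case=> ls Ds hs; split=> [|p|i p hp] /=; first exact: (plinearN ls).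
  by rewrite Ds (diffmorphN (proj1 plinear_D)).
by apply/phomogN/hs.
Qed.

Lemma subscript_add s t : subscript s -> subscript t -> subscript (s \+ t).
Proof.
move=> [ls Ds hs] [lt Dt ht]; split=> [|p|i p hp] /=; first exact: (plinearD ls lt).
  by rewrite Ds Dt (diffmorphD (proj1 plinear_D)).
by apply: phomogD; [apply: hs|apply: ht].
Qed.

Lemma subscriptB s t : subscript s -> subscript t -> subscript (s \- t).
Proof. by move=> hs /subscriptN; apply: subscript_add. Qed.

Lemma subscript_ssub s : subscript s -> subscript (\- D \- s).
Proof. by move=> hs; apply: subscriptB => //; apply/subscriptN/subscript_D. Qed.

End Subscripts.
Arguments phomog {R L} i p.

(** * Additivity, polynomial linearity and parity of $\lambda$-products *)

Section LambdaProducts.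
Variables (R : realType) (L : gradedModule R).
Implicit Types (p q r : fpoly L) (s t w : fpoly L -> fpoly L) (i j : bool).
Implicit Types (f g : L -> L -> {malg L[nat]}).

Lemma conf_linl f : conformal_product f -> forall c, diffmorph (f^~ c).
Proof.
case=> fl _ _ _ _ c a b; apply/malgP => n; rewrite mcoeffB.
have := fl n c (-1) b a; rewrite /= !scaleN1r => e.
by rewrite [a - b]addrC e addrC.
Qed.

Lemma conf_linr f : conformal_product f -> forall c, diffmorph (f c).
Proof.
case=> _ fl _ _ _ c a b; apply/malgP => n; rewrite mcoeffB.
have := fl n c (-1) b a; rewrite /= !scaleN1r => e.
by rewrite [a - b]addrC e addrC.
Qed.

Section One.
Variable f : L -> L -> {malg L[nat]}.
Hypothesis fP : conformal_product f.

Lemma lprodBl s q : diffmorph s -> diffmorph (lprod f s ^~ q).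
Proof.
move=> sB; rewrite /lprod.
apply: (msupp_sumB (F := fun (m : expo) a => \sum_(n <- msupp q)
    mulmon (addexpo m n) (evalp s (f a q@_n)))) => m a b.
rewrite -sumrB; apply: eq_bigr => n _.
by rewrite (conf_linl fP) evalpB // mulmonB.
Qed.

Lemma lprodBr s p : diffmorph s -> diffmorph (lprod f s p).
Proof.
move=> sB q r; rewrite /lprod -sumrB; apply: eq_bigr => m _.
apply: (msupp_sumB (F := fun (n : expo) a =>
    mulmon (addexpo m n) (evalp s (f p@_m a)))) => n a b.
by rewrite (conf_linr fP) evalpB // mulmonB.
Qed.

Lemma lprodU s a b m n : diffmorph s -> lprod f s << a *g m >> << b *g n >> =
  mulmon (addexpo m n) (evalp s (f a b)).
Proof.
move=> sB; rewrite /lprod (msupp_sumU (F := fun m a =>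
   \sum_(n' <- msupp << b *g n >>) mulmon (addexpo m n')
      (evalp s (f a << b *g n >>@_n')))) => [|k].
  rewrite (msupp_sumU (F := fun n b => mulmon (addexpo m n)
      (evalp s (f a b)))) // => k.
  by rewrite (diffmorph0 (conf_linr fP a)) !(diffmorph0 (evalpB _),
    diffmorph0 (@mulmonB _ _)).
apply: big1 => k' _; rewrite (diffmorph0 (conf_linl fP _)).
by rewrite !(diffmorph0 (evalpB _), diffmorph0 (@mulmonB _ _)).
Qed.

Lemma lprod_const s a b : diffmorph s ->
  lprod f s a%:FP b%:FP = evalp s (f a b).
Proof.
move=> sB; rewrite lprodU // addexpom0 {2}(monalgE (evalp s (f a b))).
by apply: eq_bigr => k _; rewrite addexpoC addexpom0.
Qed.

(** The operator [s] acts only on the inner sum over coefficients of the product; monomials of the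
    arguments are multiplied in outside it. *)
Lemma lprod_mulmonl s m p q : diffmorph s ->
  lprod f s (mulmon m p) q = mulmon m (lprod f s p q).
Proof.
move=> sB; apply: (@malg_ext _ _ _ predT (fun p => lprod f s (mulmon m p) q)
  (fun p => mulmon m (lprod f s p q))) => // [a b|a b|k a _].
- by rewrite mulmonB lprodBl.
- by rewrite lprodBl // mulmonB.
apply: (@malg_ext _ _ _ predT (fun q => lprod f s _ q)
  (fun q => mulmon m (lprod f s _ q))) => // [b c|b c|n b _].
- by rewrite lprodBr.
- by rewrite lprodBr // mulmonB.
by rewrite mulmonU !lprodU // mulmonA addexpoA.
Qed.

Lemma lprod_mulmonr s m p q : diffmorph s ->
  lprod f s p (mulmon m q) = mulmon m (lprod f s p q).
Proof.
move=> sB; apply: (@malg_ext _ _ _ predT (fun p => lprod f s p (mulmon m q))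
  (fun p => mulmon m (lprod f s p q))) => // [a b|a b|k a _].
- by rewrite lprodBl.
- by rewrite lprodBl // mulmonB.
apply: (@malg_ext _ _ _ predT (fun q => lprod f s _ (mulmon m q))
  (fun q => mulmon m (lprod f s _ q))) => // [b c|b c|n b _].
- by rewrite mulmonB lprodBr.
- by rewrite lprodBr // mulmonB.
by rewrite mulmonU !lprodU // mulmonA addexpoAC.
Qed.

Lemma plinear_lprodl s F q : subscript s -> plinear F ->
  plinear (fun p => lprod f s (F p) q).
Proof.
case=> -[sB _] _ _ [FB Fm]; split=> [a b|m p]; first by rewrite FB lprodBl.
by rewrite Fm lprod_mulmonl.
Qed.

Lemma plinear_lprodr s F p : subscript s -> plinear F ->
  plinear (fun q => lprod f s p (F q)).
Proof.
case=> -[sB _] _ _ [FB Fm]; split=> [a b|m q]; first by rewrite FB lprodBr.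
by rewrite Fm lprod_mulmonr.
Qed.

Lemma lprod_homog s i j p q : subscript s -> phomog i p -> phomog j q ->
  phomog (i (+) j) (lprod f s p q).
Proof.
move=> [_ _ hs] hp hq; apply: phomog_sum => m; apply: phomog_sum => n.
apply: phomog_mulmon; apply: phomog_sum => k; case: fP => _ _ fH _ _.
have := fH _ _ _ _ k (hp m) (hq n); move: (mcoeff k _) => c hc.
by elim: k => [|k IH] /=; [apply: phomogU|apply: hs].
Qed.

(** Transports axioms stated at [lam] to an arbitrary subscript: the substitution fixes the
    coefficients and turns each factor $\lambda$ into [s]. *)
Lemma subst_lprod_lam s t a b : subscript s -> diffmorph t ->
  subst s t (lprod f lam a%:FP b%:FP) = lprod f s a%:FP b%:FP.
Proof.
move=> [[sB _] _ _] tB; rewrite !lprod_const //; last exact: mulmonB.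
apply: (evalp_move (F := subst s t) (G := id) (w := s)) => //.
- exact: substB.
- by move=> p; rewrite subst_lam.
- by move=> k; rewrite subst_const.
Qed.

End One.
End LambdaProducts.

#[local] Opaque lprod subst evalp mulmon lam mu gam D.

Create HintDb subscripts.
#[local] Hint Resolve weight_lam weight_mu weight_gam weightD weightB
  weight_subscript subscript_ssub : subscripts.

(** * Sesquilinearity and commutativity at arbitrary subscripts *)

Section Laws.
Variables (R : realType) (L : gradedModule R).
Implicit Types (p q r : fpoly L) (s t u w : fpoly L -> fpoly L) (i j k : bool).
Implicit Types (f g : L -> L -> {malg L[nat]}).

Lemma phomog_ext F G i : plinear F -> plinear G ->
  (forall a : L, a \in homog L i -> F a%:FP = G a%:FP) ->
  forall p, phomog i p -> F p = G p.
Proof. exact: plinear_ext. Qed.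

Lemma plinear_extT (F G : fpoly L -> fpoly L) : plinear F -> plinear G ->
  (forall a : L, F a%:FP = G a%:FP) -> forall p, F p = G p.
Proof. by move=> lF lG FG p; apply: (plinear_ext (A := predT)). Qed.

Lemma subst_D s t p : subscript s -> subscript t ->
  subst s t (D p) = D (subst s t p).
Proof.
move=> [[sB _] sD _] [[tB _] tD _].
apply: (@malg_ext _ _ _ predT (fun p => subst s t (D p))
  (fun p => D (subst s t p))) => // [a b|a b|m a _].
- by rewrite (proj1 (plinear_D L)) substB.
- by rewrite substB // (proj1 (plinear_D L)).
rewrite DU !substU // -D_const.
have iD u (n : nat) q : (forall q, u (D q) = D (u q)) ->
    iter n u (D q) = D (iter n u q).
  by move=> uD; elim: n => //= n ->.
by rewrite !iD.
Qed.

Section OneProduct.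
Variable f : L -> L -> {malg L[nat]}.
Hypothesis fP : conformal_product f.

Lemma lprod_Dl s p q : subscript s ->
  lprod f s (D p) q = - s (lprod f s p q).
Proof.
move=> sS; have ls := subscript_plinear sS.
have [sB _] := ls; have idB : diffmorph (@id (fpoly L)) by [].
(* Only $\lambda$ occurs in the axiom to be substituted; [id] is a placeholder value for $\mu$. *)
have SB : diffmorph (subst s id) by apply: substB.
apply: (plinear_extT (F := fun p => lprod f s (D p) q)
  (G := fun p => - s (lprod f s p q))) => [||a].
- exact: plinear_lprodl (plinear_D L).
- by apply: plinearN; apply: plinear_comp => //; apply: plinear_lprodl.
apply: (plinear_extT (F := lprod f s (D a%:FP))
  (G := fun q => - s (lprod f s a%:FP q))) => [||b].
- exact: plinear_lprodr.
- by apply: plinearN; apply: plinear_comp => //; apply: plinear_lprodr.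
case: (fP) => _ _ _ /(_ a b)/(congr1 (subst s id)) + _.
rewrite D_const (subst_lprod_lam fP _ _ sS idB) => e; apply: (etrans e).
by rewrite (diffmorphN SB) subst_lam // subst_lprod_lam.
Qed.

Lemma lprod_Dr s p q : subscript s ->
  lprod f s p (D q) = D (lprod f s p q) + s (lprod f s p q).
Proof.
move=> sS; have ls := subscript_plinear sS.
have [sB _] := ls; have idB : diffmorph (@id (fpoly L)) by [].
have SB : diffmorph (subst s id) by apply: substB.
apply: (plinear_extT (F := fun p => lprod f s p (D q))
  (G := fun p => D (lprod f s p q) + s (lprod f s p q))) => [||a].
- exact: plinear_lprodl.
- by apply: plinearD; apply: plinear_comp => //;
    first [exact: plinear_D|exact: plinear_lprodl].
apply: (plinear_extT (F := fun q => lprod f s a%:FP (D q))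
  (G := fun q => D (lprod f s a%:FP q) + s (lprod f s a%:FP q))) => [||b].
- exact: plinear_lprodr (plinear_D L).
- by apply: plinearD; apply: plinear_comp => //;
    first [exact: plinear_D|exact: plinear_lprodr].
case: (fP) => _ _ _ _ /(_ a b)/(congr1 (subst s id)).
rewrite D_const (subst_lprod_lam fP _ _ sS idB) => e; apply: (etrans e) => /=.
by rewrite (diffmorphD SB) subst_lam // subst_D // subst_lprod_lam.
Qed.

Lemma subst_lprod s t u w a b : diffmorph s -> diffmorph t -> diffmorph u ->
  diffmorph w -> (forall p, subst s t (u p) = w (subst s t p)) ->
  subst s t (lprod f u a%:FP b%:FP) = lprod f w a%:FP b%:FP.
Proof.
move=> sB tB uB wB uw; rewrite !lprod_const //.
apply: (evalp_move (F := subst s t) (G := id) (w := w)) => //.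
- exact: substB.
- by move=> k; rewrite subst_const.
Qed.

(* [n] is the sign by which f commutes on parities i and j. *)
Definition lprod_sym i j (n : int) :=
  forall a b : L, a \in homog L i -> b \in homog L j ->
    lprod f lam a%:FP b%:FP = lprod f (\- D \- lam) b%:FP a%:FP *~ n.

Lemma lprod_comm i j n s p q : lprod_sym i j n -> subscript s ->
  phomog i p -> phomog j q ->
  lprod f s p q = lprod f (\- D \- s) q p *~ n.
Proof.
move=> fn sS hp hq; have [[sB _] _ _] := sS.
have nS : subscript (\- D \- s) by apply: subscript_ssub.
have [[nB _] _ _] := nS.
apply: (phomog_ext (F := fun p => lprod f s p q)
  (G := fun p => lprod f (\- D \- s) q p *~ n)) hp.
- exact: plinear_lprodl.
- by apply: plinearMz; apply: plinear_lprodr.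
move=> a ha; apply: (phomog_ext (F := lprod f s a%:FP)
  (G := fun q => lprod f (\- D \- s) q a%:FP *~ n)) hq.
- exact: plinear_lprodr.
- by apply: plinearMz; apply: plinear_lprodl.
move=> b hb; have := congr1 (subst s id) (fn a b ha hb).
rewrite subst_lprod_lam // => ->.
have SB : diffmorph (subst s id) by apply: substB.
rewrite (diffmorphMz SB); apply: (congr1 (fun x : fpoly L => x *~ n)).
apply: subst_lprod => //.
  by case: (subscript_ssub (weight_subscript (weight_lam L))) => -[].
have idS : subscript (@id (fpoly L)) by [].
(* Since [s] commutes with [D], the substitution turns $-\partial-\lambda$ into $-\partial-s$. *)
by move=> p'; rewrite /= SB subst_lam // (diffmorphN SB) subst_D.
Qed.

End OneProduct.

(** Commuting the inner factors produces the subscript $-\partial-s$. Under the outer subscript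
    $s+t$, sesquilinearity makes $\partial$ on the inner product act as $-(s+t)$, so that subscript
    becomes $(s+t)-s=t$. *)
Lemma lprod_inner f g i j n s t p q r :
  conformal_product f -> conformal_product g -> lprod_sym f i j n ->
  weight s -> weight t -> phomog i p -> phomog j q ->
  lprod g (s \+ t) (lprod f s p q) r
  = lprod g (s \+ t) (lprod f t q p) r *~ n.
Proof.
move=> fP gP fn hs ht hp hq.
have [sS tS] := (weight_subscript hs, weight_subscript ht).
have nS := subscript_ssub sS; have stS := weight_subscript (weightD hs ht).
have gB x : diffmorph (lprod g (s \+ t) ^~ x).
  by apply: lprodBl => //; case: stS => -[].
rewrite (lprod_comm fP fn sS hp hq) (diffmorphMz (gB r)).
apply: (congr1 (fun x : fpoly L => x *~ n)).
apply: (plinear_extT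
  (F := fun q => lprod g (s \+ t) (lprod f (\- D \- s) q p) r)
  (G := fun q => lprod g (s \+ t) (lprod f t q p) r)) => [||a].
- by do 2! apply: plinear_lprodl => //.
- by do 2! apply: plinear_lprodl => //.
apply: (plinear_extT
  (F := fun p => lprod g (s \+ t) (lprod f (\- D \- s) a%:FP p) r)
  (G := fun p => lprod g (s \+ t) (lprod f t a%:FP p) r)) => [||b].
- by apply: plinear_lprodl => //; apply: plinear_lprodr.
- by apply: plinear_lprodl => //; apply: plinear_lprodr.
rewrite !(lprod_const fP); first last.
- by case: nS => -[].
- by case: tS => -[].
have cen w x : weight w ->
    lprod g (s \+ t) (w x) r = w (lprod g (s \+ t) x r).
  by move=> hw; apply: (weight_central hw (F := fun x => lprod g (s \+ t) x r));
    apply: plinear_lprodl.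
apply: (evalp_move (F := fun x => lprod g (s \+ t) x r)
  (G := fun x => lprod g (s \+ t) x r) (w := t)) => // x; last exact: cen.
rewrite /= gB (diffmorphN (gB r)) lprod_Dl // opprK cen //.
by rewrite addrAC subrr add0r.
Qed.

(** * Substitution into nested products *)

Section Nested.
Variables f g : L -> L -> {malg L[nat]}.
Hypotheses (fP : conformal_product f) (gP : conformal_product g).
Variables s t u w u' w' : fpoly L -> fpoly L.
Hypotheses (sB : diffmorph s) (tB : diffmorph t).
Hypotheses (uS : subscript u) (uS' : subscript u') (wS : weight w).
Hypothesis wS' : weight w'.
Hypothesis uu' : forall p, subst s t (u p) = u' (subst s t p).
Hypothesis ww' : forall p, subst s t (w p) = w' (subst s t p).

Let SB : diffmorph (subst s t). Proof. exact: substB. Qed.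
Let uB : diffmorph u. Proof. by case: uS => -[]. Qed.
Let uB' : diffmorph u'. Proof. by case: uS' => -[]. Qed.
Let wB : diffmorph w. Proof. by case: wS => -[]. Qed.
Let wB' : diffmorph w'. Proof. by case: wS' => -[]. Qed.

(** The inner subscript is a weight, so its powers come out of the outer product and can be
    substituted there; only products of constants remain. *)
Lemma subst_nestr a b c :
  subst s t (lprod f u a%:FP (lprod g w b%:FP c%:FP))
  = lprod f u' a%:FP (lprod g w' b%:FP c%:FP).
Proof.
rewrite !(lprod_const gP) //.
apply: (evalp_move (F := fun x => subst s t (lprod f u a%:FP x))
  (G := lprod f u' a%:FP) (w := w')) => [x y|x y|x|x|k].
- by rewrite lprodBr.
- by rewrite lprodBr.
- by rewrite (weight_central wS (F := lprod f u a%:FP)) // ?ww' //;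
    apply: plinear_lprodr.
- by rewrite (weight_central wS' (F := lprod f u' a%:FP)) //;
    apply: plinear_lprodr.
- exact: subst_lprod.
Qed.

Lemma subst_nestl a b c :
  subst s t (lprod f u (lprod g w a%:FP b%:FP) c%:FP)
  = lprod f u' (lprod g w' a%:FP b%:FP) c%:FP.
Proof.
rewrite !(lprod_const gP) //.
apply: (evalp_move (F := fun x => subst s t (lprod f u x c%:FP))
  (G := fun x => lprod f u' x c%:FP) (w := w')) => [x y|x y|x|x|k].
- by rewrite lprodBl.
- by rewrite lprodBl.
- by rewrite (weight_central wS (F := fun x => lprod f u x c%:FP)) // ?ww' //;
    apply: plinear_lprodl.
- by rewrite (weight_central wS' (F := fun x => lprod f u' x c%:FP)) //;
    apply: plinear_lprodl.
- exact: subst_lprod.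
Qed.

End Nested.

Lemma phomog_ext3 (F G : fpoly L -> fpoly L -> fpoly L -> fpoly L) i j k :
  (forall q r, plinear (fun p => F p q r)) ->
  (forall q r, plinear (fun p => G p q r)) ->
  (forall p r, plinear (fun q => F p q r)) ->
  (forall p r, plinear (fun q => G p q r)) ->
  (forall p q, plinear (fun r => F p q r)) ->
  (forall p q, plinear (fun r => G p q r)) ->
  (forall a b c : L, a \in homog L i -> b \in homog L j -> c \in homog L k ->
     F a%:FP b%:FP c%:FP = G a%:FP b%:FP c%:FP) ->
  forall p q r, phomog i p -> phomog j q -> phomog k r -> F p q r = G p q r.
Proof.
move=> F1 G1 F2 G2 F3 G3 FG p q r hp hq hr.
apply: (phomog_ext (F := fun p => F p q r) (G := fun p => G p q r)) hp => //.
move=> a ha.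
apply: (phomog_ext (F := fun q => F _ q r) (G := fun q => G _ q r)) hq => //.
move=> b hb; apply: phomog_ext hr => // c hc; exact: FG.
Qed.

End Laws.

(** * Transposed Poisson identities *)

Section LinearCombinations.
Variables (P Q : zmodType) (F : P -> Q).
Hypothesis FB : diffmorph F.

Lemma eqD (p q p' q' : P) : p = q -> p' = q' -> p + p' = q + q'.
Proof. by move=> -> ->. Qed.

Lemma eqM (p q : P) (n : int) : p = q -> p *~ n = q *~ n.
Proof. by move=> ->. Qed.

Lemma eq_by (p q p' q' : P) : p = q -> p' - q' = p - q -> p' = q'.
Proof. by move=> ->; rewrite subrr; apply: subr0_eq. Qed.

Lemma map_eqMz p q n : p = q *~ n -> F p = F q *~ n.
Proof. by move=> ->; rewrite (diffmorphMz FB). Qed.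

Lemma map_eqD p q r n : p = q + r *~ n -> F p = F q + F r *~ n.
Proof. by move=> ->; rewrite (diffmorphD FB) (diffmorphMz FB). Qed.

Lemma map_eq2D p q r n : p *+ 2 = q + r *~ n -> F p *+ 2 = F q + F r *~ n.
Proof. by move=> e; rewrite mulr2n -(diffmorphD FB) -mulr2n; apply: map_eqD. Qed.

Lemma map_eq0 p q r n : p - q *~ n + r = 0 -> F p - F q *~ n + F r = 0.
Proof.
move=> e; rewrite -(diffmorphMz FB) -FB -(diffmorphD FB) e.
exact: diffmorph0.
Qed.

End LinearCombinations.

Ltac parity_cases :=
  repeat match goal with
  | |- context [nat_of_bool ?b] => is_var b; case: (b)
  | |- context [addb ?b _] => is_var b; case: (b)
  | |- context [addb _ ?b] => is_var b; case: (b)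
  end.

(** Proof by certificate: [e] is an integral combination of known equations whose two sides differ
    by the same amount as those of the goal. Splitting on parities makes all signs numerical. *)
Ltac linear_by e := refine (eq_by e _); cbv beta; parity_cases; zmod.

Notation "e + e'" := (eqD e e') : eq_scope.
Notation "e * n" := (eqM n%R e) : eq_scope.
Delimit Scope eq_scope with EQ.

Section Identities.
Variables (P : zmodType) (H : bool -> P -> Prop) (W : (P -> P) -> Prop).
Variables C B : (P -> P) -> P -> P -> P.

Local Notation "''e_' ( i , j )" := ((-1 : int) ^+ (i * j))
  (at level 8, format "''e_' ( i ,  j )").

(* The laws of a transposed Poisson superalgebra in conformal form: [C s] and
   [B s] are the product and the bracket, and the subscripts are weights, which
   do not involve the derivation.  The rightmost argument of every term carries
   no weight; leibniz_last is the Leibniz rule with the weight of p there. *)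
Record weighted_laws : Prop := WeightedLaws {
  wl_add : forall s t, W s -> W t -> W (s \+ t);
  wl_extC : forall s t p q, s =1 t -> C s p q = C t p q;
  wl_extB : forall s t p q, s =1 t -> B s p q = B t p q;
  wl_Cl : forall s q, W s -> diffmorph (C s ^~ q);
  wl_Cr : forall s p, W s -> diffmorph (C s p);
  wl_Bl : forall s q, W s -> diffmorph (B s ^~ q);
  wl_Br : forall s p, W s -> diffmorph (B s p);
  wl_CH : forall s i j p q, W s -> H i p -> H j q -> H (i (+) j) (C s p q);
  wl_BH : forall s i j p q, W s -> H i p -> H j q -> H (i (+) j) (B s p q);
  wl_commC : forall s t i j p q r, W s -> W t -> H i p -> H j q ->
    C (s \+ t) (C s p q) r = C (s \+ t) (C t q p) r *~ 'e_(i, j);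
  wl_commB : forall s t i j p q r, W s -> W t -> H i p -> H j q ->
    B (s \+ t) (C s p q) r = B (s \+ t) (C t q p) r *~ 'e_(i, j);
  wl_assoc : forall s t i j k p q r, W s -> W t -> H i p -> H j q -> H k r ->
    C s p (C t q r) = C (s \+ t) (C s p q) r;
  wl_jacobi : forall s t i j k p q r, W s -> W t -> H i p -> H j q -> H k r ->
    B s p (B t q r) = B (s \+ t) (B s p q) r + B t q (B s p r) *~ 'e_(i, j);
  wl_leibniz : forall s t i j k p q r, W s -> W t -> H i p -> H j q -> H k r ->
    C s p (B t q r) *+ 2
    = B (s \+ t) (C s p q) r + B t q (C s p r) *~ 'e_(i, j);
  wl_leibniz_last : forall s t i j k p q r,
    W s -> W t -> H i p -> H j q -> H k r ->
    C (s \+ t) (B s p q) r *+ 2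
    = B s p (C t q r) + B t q (C s p r) *~ (- 'e_(i, j));
  wl_inj2 : forall p q : P, p *+ 2 = q *+ 2 -> p = q
}.

Hypothesis laws : weighted_laws.
Let extC := wl_extC laws.
Let extB := wl_extB laws.
Let inj2 := wl_inj2 laws.
Let assoc := wl_assoc laws.
Let jacobi := wl_jacobi laws.
Let leibniz := wl_leibniz laws.
Let leibniz_last := wl_leibniz_last laws.
Let Cr := wl_Cr laws.
Let Bl := wl_Bl laws.
Let Br := wl_Br laws.
Let CH := wl_CH laws.
Let BH := wl_BH laws.
Let addW := wl_add laws.

Lemma subscriptC (s t : P -> P) : s \+ t =1 t \+ s.
Proof. by move=> p /=; rewrite addrC. Qed.

(** Associativity gathers both multipliers into one product, where commutativity exchanges them. *)
Lemma left_comm s t i j k p q r : W s -> W t -> H i p -> H j q -> H k r ->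
  C t q (C s p r) = C (s \+ t) (C s p q) r *~ 'e_(i, j).
Proof.
move=> sW tW hp hq hr; rewrite (assoc tW sW hq hp hr).
rewrite (wl_commC laws _ tW sW hq hp) mulnC; congr (_ *~ _).
exact/extC/subscriptC.
Qed.

Lemma cyclic_CB s t i j k p q r : W s -> W t -> H i p -> H j q -> H k r ->
  C s p (B t q r) - C t q (B s p r) *~ 'e_(i, j) + C (s \+ t) (B s p q) r = 0.
Proof.
move=> sW tW hp hq hr; apply: inj2.
have l1 := leibniz sW tW hp hq hr; have l2 := leibniz tW sW hq hp hr.
have l3 := leibniz_last sW tW hp hq hr.
(* In the signed sum of the three rules, $[q,pr]$ and $[p,qr]$ cancel in pairs; [c] cancels the
   remaining $[pq,r]$ against $[qp,r]$. *)
have c := wl_commB laws r tW sW hq hp.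
rewrite !(extB _ _ (subscriptC t s)) in l2 c.
linear_by (l1 + l2 * - 'e_(i, j) + l3 + c * - 'e_(i, j))%EQ.
Qed.

(** * Cyclic identities for a triple and a fourth element [h] *)

Section FourElements.
Variables (s t u : P -> P) (a i j k : bool) (h x y z : P).
Hypotheses (sW : W s) (tW : W t) (uW : W u).
Hypotheses (hh : H a h) (hx : H i x) (hy : H j y) (hz : H k z).

Let stW := addW sW tW.
Let suW := addW sW uW.
Let tuW := addW tW uW.
Let stuW := addW sW tuW.

(** Leibniz is applied to $h$ times each of the three terms of the Jacobi identity; every
    application contributes one term to each side. *)
Lemma cyclic_BCB_eq_BC_B :
  B (s \+ (t \+ u)) (C s h (B t x y)) z
  - B t x (C s h (B u y z)) *~ 'e_(a, i)
  + B u y (C s h (B t x z)) *~ ('e_(a, j) * 'e_(i, j))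
  = B (s \+ t) (C s h x) (B u y z)
  - B (s \+ u) (C s h y) (B t x z) *~ 'e_(i, j)
  - B (t \+ u) (B t x y) (C s h z) *~ ('e_(a, i) * 'e_(a, j)).
Proof.
have m1 := leibniz sW tuW hh (BH tW hx hy) hz.
have m2 := leibniz sW tW hh hx (BH uW hy hz).
have m3 := leibniz sW uW hh hy (BH tW hx hz).
have m := map_eqD (Cr h sW) (jacobi tW uW hx hy hz).
linear_by (m1 * -1 + m2 + m3 * - 'e_(i, j) + m * -2)%EQ.
Qed.

Lemma cyclic_BCB :
  B (s \+ (t \+ u)) (C s h (B t x y)) z
  - B t x (C s h (B u y z)) *~ 'e_(a, i)
  + B u y (C s h (B t x z)) *~ ('e_(a, j) * 'e_(i, j)) = 0.
Proof.
(* The equations [n1], [n2], [n3] expand $2h[\cdot,\cdot]$ inside the outer brackets. Jacobi for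
   $(hx,y,z)$, $(x,hy,z)$ and $(x,y,hz)$ then collects the six terms into the right side of [m], so
   twice the sum equals the sum. *)
have n1 := map_eq2D (Bl z stuW) (leibniz sW tW hh hx hy).
have n2 := map_eq2D (Br x tW) (leibniz sW uW hh hy hz).
have n3 := map_eq2D (Br y uW) (leibniz sW tW hh hx hz).
have j1 := jacobi stW uW (CH sW hh hx) hy hz.
have j2 := jacobi tW suW hx (CH sW hh hy) hz.
have j3 := jacobi tW uW hx hy (CH sW hh hz).
have e1 : (s \+ t) \+ u =1 s \+ (t \+ u) by move=> p /=; rewrite addrA.
have e2 : t \+ (s \+ u) =1 s \+ (t \+ u) by move=> p /=; rewrite addrCA.
rewrite (extB _ _ e1) in j1; rewrite (extB _ _ e2) in j2.
have m := cyclic_BCB_eq_BC_B.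
linear_by (n1 + n2 * - 'e_(a, i) + n3 * ('e_(a, j) * 'e_(i, j)) + j1 * -1
  + j2 * - 'e_(a, i) + j3 * - ('e_(a, i) * 'e_(a, j)) + m * -1)%EQ.
Qed.

Lemma cyclic_BC_B :
  B (s \+ t) (C s h x) (B u y z)
  - B (s \+ u) (C s h y) (B t x z) *~ 'e_(i, j)
  - B (t \+ u) (B t x y) (C s h z) *~ ('e_(a, i) * 'e_(a, j)) = 0.
Proof. by rewrite -cyclic_BCB_eq_BC_B cyclic_BCB. Qed.

Lemma cyclic_CBB :
  C (s \+ t) (B s h x) (B u y z)
  - C (s \+ u) (B s h y) (B t x z) *~ 'e_(i, j)
  + C (t \+ u) (B t x y) (B s h z) *~ ('e_(a, i) * 'e_(a, j)) = 0.
Proof.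
apply: inj2.
(* Leibniz writes twice each summand as brackets of products; the third needs the last-weight form
   because $[h,z]$ carries no weight. Then [p1], [p2], [p3] merge products such as $[h,x]z$ and
   $x[h,z]$ into $h[x,z]$ inside these brackets, leaving the sum in [m]. *)
have l1 := leibniz stW uW (BH sW hh hx) hy hz.
have l2 := leibniz suW tW (BH sW hh hy) hx hz.
have l3 := leibniz_last tW uW hx hy (BH sW hh hz).
have p1 := map_eq0 (Br y uW) (cyclic_CB sW tW hh hx hz).
have p2 := map_eq0 (Br x tW) (cyclic_CB sW uW hh hy hz).
have p3 := map_eq0 (Bl z stuW) (cyclic_CB sW tW hh hx hy).
have c := wl_commB laws z suW tW (BH sW hh hy) hx.
have e1 : (s \+ t) \+ u =1 s \+ (t \+ u) by move=> p /=; rewrite addrA.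
have e2 : (s \+ u) \+ t =1 s \+ (t \+ u).
  by move=> p /=; rewrite addrAC addrA.
rewrite (extB _ _ e1) in l1; rewrite !(extB _ _ e2) in l2 c.
have m := cyclic_BCB.
linear_by (l1 + l2 * - 'e_(i, j) + l3 * ('e_(a, i) * 'e_(a, j)) + p3
  + c * - 'e_(i, j) + p1 * ('e_(a, j) * 'e_(i, j)) + p2 * - 'e_(a, i)
  + m * -1)%EQ.
Qed.

End FourElements.

(** * Identities with two multipliers [u] and [v] *)

Section TwoMultipliers.
Variables (s t w : P -> P) (a b i j : bool) (u v x y : P).
Hypotheses (sW : W s) (tW : W t) (wW : W w).
Hypotheses (hu : H a u) (hv : H b v) (hx : H i x) (hy : H j y).

Let stW := addW sW tW.
Let swW := addW sW wW.
Let twW := addW tW wW.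
Let stwW := addW stW wW.

(** Up to signs, the left sides of [a1] to [a4] add up to $8(uv)[x,y]$ by [b1] and [b2]. Their right
    sides give twice the wanted sum plus $2[(uv)x,y]+2[x,(uv)y]$, which is $4(uv)[x,y]$ by [c1].
    Hence twice the sum is $4(uv)[x,y]$. *)
Lemma B_CC :
  B (s \+ w) (C s u x) (C t v y) *~ 'e_(b, i)
  + B (t \+ w) (C t v x) (C s u y) *~ ((-1) ^+ (a * (i + b)))
  = C (s \+ t) (C s u v) (B w x y) *+ 2.
Proof.
apply: inj2.
have a1 := leibniz sW wW hu hx (CH tW hv hy).
have a2 := leibniz tW wW hv hx (CH sW hu hy).
have a3 := leibniz tW swW hv (CH sW hu hx) hy.
have a4 := leibniz sW twW hu (CH tW hv hx) hy.
have b1 := map_eq2D (Cr u sW) (leibniz tW wW hv hx hy).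
have b2 := map_eq2D (Cr v tW) (leibniz sW wW hu hx hy).
have c1 := leibniz stW wW (CH sW hu hv) hx hy.
have d1 := assoc sW tW hu hv (BH wW hx hy).
have d2 := left_comm sW tW hu hv (BH wW hx hy).
have f1 := congr1 (B w x) (assoc sW tW hu hv hy).
have f2 := map_eqMz (Br x wW) (left_comm sW tW hu hv hy).
have g1 := congr1 ((B ((s \+ t) \+ w))^~ y) (assoc sW tW hu hv hx).
have g2 := map_eqMz (Bl y stwW) (left_comm sW tW hu hv hx).
have e1 : s \+ (t \+ w) =1 (s \+ t) \+ w by move=> p /=; rewrite addrA.
have e2 : t \+ (s \+ w) =1 (s \+ t) \+ w.
  by move=> p /=; rewrite addrCA addrA.
rewrite (extB _ _ e2) in a3; rewrite (extB _ _ e1) in a4.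
linear_by (a1 * - 'e_(b, i) + a2 * - ('e_(a, i) * 'e_(a, b)) + a3 * - 'e_(a, b)
  + a4 * -1 + b1 * -2 + b2 * (- 'e_(a, b) * 2) + c1 * 2 + d1 * 4
  + d2 * ('e_(a, b) * 4) + f1 * - ('e_(b, i) * 'e_(a, i))
  + f2 * - ('e_(a, i) * 'e_(a, b) * 'e_(b, i)) + g1 * -1
  + g2 * - 'e_(a, b))%EQ.
Qed.

(** Up to signs, add the three-term identities for $(x,u,vy)$ and $(vx,u,y)$ and subtract $v$ times
    that for $(x,u,y)$. The terms in $[x,u]$ and $[u,y]$ cancel by associativity and commutativity;
    [b1] yields $2(uv)[x,y]$, of which [q3] removes one copy. *)
Lemma C_B_C :
  C w x (B s u (C t v y)) *~ 'e_(b, i)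
  + C ((t \+ w) \+ s) (B (t \+ w) (C t v x) u) y *~ 'e_(a, b)
  - C (s \+ t) (C s u v) (B w x y) *~ 'e_(a, i) = 0.
Proof.
have q1 := cyclic_CB wW sW hx hu (CH tW hv hy).
have q2 := cyclic_CB twW sW (CH tW hv hx) hu hy.
have q3 := map_eq0 (Cr v tW) (cyclic_CB wW sW hx hu hy).
have b1 := map_eq2D (Cr u sW) (leibniz tW wW hv hx hy).
have d1 := assoc sW tW hu hv (BH wW hx hy).
have d2 := left_comm sW tW hu hv (BH wW hx hy).
have wsW := addW wW sW.
have r1 := assoc wsW tW (BH wW hx hu) hv hy.
have r1' := left_comm wsW tW (BH wW hx hu) hv hy.
have r2 := assoc tW wW hv hx (BH sW hu hy).
linear_by (q1 * 'e_(b, i) + q2 * 'e_(a, b) + b1 * - 'e_(a, i)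
  + d1 * ('e_(a, i) * 2) + r1 * - 'e_(b, i) + r1' * 'e_(a, b)
  + r2 * 'e_(a, b) + q3 * - 'e_(a, b) + d2 * - ('e_(a, b) * 'e_(a, i)))%EQ.
Qed.

End TwoMultipliers.
End Identities.

(** * Transposed Poisson conformal superalgebras *)

Section ConformalLaws.
Variables (R : realType) (L : TPCSA R).
Implicit Types (p q r : fpoly L) (s t u w : fpoly L -> fpoly L) (i j k : bool).

Local Notation circ := (@tpcsa_circ R L).
Local Notation brk := (@tpcsa_brk R L).

Lemma circP : conformal_product circ.
Proof. by case: (tpcsa_circP L). Qed.

Lemma brkP : conformal_product brk.
Proof. by case: (tpcsa_brkP L). Qed.

Ltac conf := solve [simple apply circP | simple apply brkP].
Ltac plin :=
  lazymatch goal with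
  | |- plinear (fun p => p) => exact: plinear_id
  | |- plinear (fun p => _ + _) => apply: plinearD; plin
  | |- plinear (fun p => - _) => apply: plinearN; plin
  | |- plinear (fun p => _ *~ _) => apply: plinearMz; plin
  | |- plinear (fun p => _ *+ _) => apply: plinearMn; plin
  | |- plinear (fun p => lprod ?f ?s (@?F p) (@?G p)) =>
      lazymatch G with
      | fun _ => ?q =>
          refine (@plinear_lprodl _ _ f _ s F q _ _);
          [conf|solve [auto with subscripts]|plin]
      | _ =>
          lazymatch F with
          | fun _ => ?q =>
              refine (@plinear_lprodr _ _ f _ s G q _ _);
              [conf|solve [auto with subscripts]|plin]
          end
      end
  | |- plinear (lprod ?f ?s ?q) =>
      refine (@plinear_lprodr _ _ f _ s (fun p => p) q _ _);
      [conf|solve [auto with subscripts]|exact: plinear_id]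
  end.



Lemma circ_sym i j : lprod_sym circ i j ((-1) ^+ (i * j)).
Proof. by move=> a b ha hb; case: (tpcsa_circP L) => _ + _; apply. Qed.

Lemma brk_sym i j : lprod_sym brk i j (- (-1) ^+ (i * j)).
Proof.
move=> a b ha hb; case: (tpcsa_brkP L) => _ + _ => /(_ _ _ _ _ ha hb) e.
apply: (etrans e).
have -> : lprod brk (\- lam \- D) b%:FP a%:FP = lprod brk (\- D \- lam) b%:FP a%:FP.
  by apply: eq_lprod => x /=; rewrite addrC.
by apply: esym; set X := lprod _ _ _ _; apply: (mulrNz X).
Qed.

(** * Associativity, Jacobi and Leibniz rules at arbitrary weights *)

Section Weights.
Variables s t : fpoly L -> fpoly L.
Hypotheses (sW : weight s) (tW : weight t).

Let sS : subscript s. Proof. exact: weight_subscript. Qed.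
Let tS : subscript t. Proof. exact: weight_subscript. Qed.
Let sB : diffmorph s. Proof. by case: sS => -[]. Qed.
Let tB : diffmorph t. Proof. by case: tS => -[]. Qed.
Let lamS : subscript (@lam L). Proof. exact: weight_subscript (weight_lam L). Qed.
Let muS : subscript (@mu L). Proof. exact: weight_subscript (weight_mu L). Qed.
Let lamW := weight_lam L.
Let muW := weight_mu L.
Let lmW : weight (@lam L \+ mu). Proof. by auto with subscripts. Qed.
Let lmS : subscript (@lam L \+ mu). Proof. exact: weight_subscript. Qed.
Let stS : subscript (s \+ t). Proof. by auto with subscripts. Qed.
Let SB : diffmorph (subst s t). Proof. exact: substB. Qed.
Let Slam p : subst s t (lam p) = s (subst s t p). Proof. exact: subst_lam. Qed.
Let Smu p : subst s t (mu p) = t (subst s t p).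
Proof. by apply: subst_mu => // q; case: tW => _ -> //; case: sS. Qed.
Let Slm p : subst s t ((lam \+ mu) p) = (s \+ t) (subst s t p).
Proof. by rewrite /= (diffmorphD SB) Slam Smu. Qed.

Lemma assoc i j k p q r : phomog i p -> phomog j q -> phomog k r ->
  p ∘_[s] (q ∘_[t] r) = (p ∘_[s] q) ∘_[s \+ t] r.
Proof.
move=> hp hq hr.
refine (phomog_ext3 (F := fun p q r => p ∘_[s] (q ∘_[t] r))
  (G := fun p q r => (p ∘_[s] q) ∘_[s \+ t] r) _ _ _ _ _ _ _ hp hq hr);
  try by move=> ? ?; cbv beta; plin.
move=> a b c _ _ _.
case: (tpcsa_circP L) => _ _ /(_ a b c)/(congr1 (subst s t)) e.
apply: (etrans (esym (subst_nestr circP circP sB tB lamS sS muW tW Slam Smu a b c))).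
exact: (etrans e (subst_nestl circP circP sB tB lmS stS lamW sW Slm Slam a b c)).
Qed.

Lemma jacobi_weight i j k p q r : phomog i p -> phomog j q -> phomog k r ->
  ⟦p ,_[s] ⟦q ,_[t] r⟧⟧
  = ⟦⟦p ,_[s] q⟧ ,_[s \+ t] r⟧ + ⟦q ,_[t] ⟦p ,_[s] r⟧⟧ *~ (-1) ^+ (i * j).
Proof.
move=> hp hq hr.
refine (phomog_ext3 (F := fun p q r => ⟦p ,_[s] ⟦q ,_[t] r⟧⟧)
  (G := fun p q r => ⟦⟦p ,_[s] q⟧ ,_[s \+ t] r⟧
    + ⟦q ,_[t] ⟦p ,_[s] r⟧⟧ *~ (-1) ^+ (i * j)) _ _ _ _ _ _ _ hp hq hr);
  try by move=> ? ?; cbv beta; plin.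
move=> a b c ha hb _; case: (tpcsa_brkP L) => _ _ /(_ _ _ _ _ c ha hb) e.
have := congr1 (subst s t) e => {}e.
apply: (etrans (esym (subst_nestr brkP brkP sB tB lamS sS muW tW Slam Smu a b c))).
apply: (etrans e); apply: (etrans (map_eqD SB (erefl _))).
apply: (eqD (subst_nestl brkP brkP sB tB lmS stS lamW sW Slm Slam a b c)).
apply: eqM.
exact: (subst_nestr brkP brkP sB tB muS tS lamW sW Smu Slam b a c).
Qed.

Lemma leibniz_weight i j k p q r : phomog i p -> phomog j q -> phomog k r ->
  (p ∘_[s] ⟦q ,_[t] r⟧) *+ 2
  = ⟦p ∘_[s] q ,_[s \+ t] r⟧ + ⟦q ,_[t] p ∘_[s] r⟧ *~ (-1) ^+ (i * j).
Proof.
move=> hp hq hr.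
refine (phomog_ext3 (F := fun p q r => (p ∘_[s] ⟦q ,_[t] r⟧) *+ 2)
  (G := fun p q r => ⟦p ∘_[s] q ,_[s \+ t] r⟧
    + ⟦q ,_[t] p ∘_[s] r⟧ *~ (-1) ^+ (i * j)) _ _ _ _ _ _ _ hp hq hr);
  try by move=> ? ?; cbv beta; plin.
move=> a b c ha hb _.
have e := map_eq2D SB (tpcsa_leibniz c ha hb).
have e0 := subst_nestr circP brkP sB tB lamS sS muW tW Slam Smu a b c.
apply: (etrans (congr1 (fun x => x *+ 2) (esym e0))); apply: (etrans e).
apply: (eqD (subst_nestl brkP circP sB tB lmS stS lamW sW Slm Slam a b c)).
apply: eqM.
exact: (subst_nestr brkP circP sB tB muS tS lamW sW Smu Slam b a c).
Qed.

End Weights.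

(** * The Leibniz rule with the unweighted factor outside the bracket *)

Section LastWeight.
Variables s t : fpoly L -> fpoly L.
Hypotheses (sW : weight s) (tW : weight t).

Let sS : subscript s. Proof. exact: weight_subscript. Qed.
Let tS : subscript t. Proof. exact: weight_subscript. Qed.
Let stS : subscript (s \+ t). Proof. by auto with subscripts. Qed.
Let n : fpoly L -> fpoly L := \- D \- (s \+ t).
Let nS : subscript n. Proof. exact: subscript_ssub. Qed.
Let nB : diffmorph n. Proof. by case: nS => -[]. Qed.
Let sB : diffmorph s. Proof. by case: sS => -[]. Qed.
Let lamS : subscript (@lam L). Proof. exact: weight_subscript (weight_lam L). Qed.
Let lamW := weight_lam L.
Let muW := weight_mu L.
Let muS : subscript (@mu L). Proof. exact: weight_subscript. Qed.
Let lmW : weight (@lam L \+ mu). Proof. by auto with subscripts. Qed.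
Let lmS : subscript (@lam L \+ mu). Proof. exact: weight_subscript. Qed.
Let nsS : subscript (n \+ s). Proof. exact: subscript_add. Qed.
Let SB : diffmorph (subst n s). Proof. exact: substB. Qed.
Let Slam p : subst n s (lam p) = n (subst n s p). Proof. exact: subst_lam. Qed.
Let Smu p : subst n s (mu p) = s (subst n s p).
Proof. by apply: subst_mu => // q; case: sW => _ -> //; case: nS. Qed.
Let Slm p : subst n s ((lam \+ mu) p) = (n \+ s) (subst n s p).
Proof. by rewrite /= (diffmorphD SB) Slam Smu. Qed.
Let SD p : subst n s (D p) = D (subst n s p). Proof. exact: subst_D. Qed.

(** Taken out of $[a_\mu\,\cdot\,]$, the inner $\partial$ becomes $\partial+\mu$. The inner
    subscript therefore becomes $-(\partial+s)-n$, which is $t$ since $n=-\partial-s-t$. *)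
Let subst_inner a b c :
  subst n s ⟦a%:FP ,_[mu] b%:FP ∘_[\- D \- lam] c%:FP⟧
  = ⟦a%:FP ,_[s] b%:FP ∘_[t] c%:FP⟧.
Proof.
have lS : subscript (\- D \- (@lam L)) by apply: subscript_ssub.
have muB x : diffmorph (lprod brk mu x).
  by apply: (lprodBr brkP x); case: muS => -[].
have sB' x : diffmorph (lprod brk s x) by exact: (lprodBr brkP x sB).
rewrite !(lprod_const circP); first last.
- by case: lS => -[].
- by case: tS => -[].
apply: (evalp_move (F := fun x => subst n s ⟦a%:FP ,_[mu] x⟧)
  (G := lprod brk s a%:FP) (w := t)) => [x y|x y|x|x|k].
- by rewrite muB SB.
- by rewrite sB'.
- have e : lprod brk mu a%:FP ((\- D \- lam) x)
      = - (D (lprod brk mu a%:FP x) + mu (lprod brk mu a%:FP x))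
        - lam (lprod brk mu a%:FP x).
    rewrite /= muB (diffmorphN (muB _)) (lprod_Dr brkP _ _ muS).
    congr (_ - _).
    apply: (weight_central lamW (F := lprod brk mu a%:FP)).
    exact: (plinear_lprodr brkP _ muS (@plinear_id _)).
  rewrite e SB (diffmorphN SB) (diffmorphD SB) SD Smu Slam /n /=.
  move: (subst _ _ _) => X; move: (D X) (s X) (t X) => ? ? ?; zmod.
- apply: (weight_central tW (F := lprod brk s a%:FP)).
  exact: (plinear_lprodr brkP _ sS (@plinear_id _)).
- by apply: (subst_lprod brkP _ _ nB sB _ sB Smu); case: muS => -[].
Qed.

(* The Leibniz rule for r, p, q at lambda := - D - s - t and mu := s, the
   weight of r being moved away by commutativity. *)
Lemma leibniz_last i j k p q r : phomog i p -> phomog j q -> phomog k r ->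
  (⟦p ,_[s] q⟧ ∘_[s \+ t] r) *+ 2
  = ⟦p ,_[s] q ∘_[t] r⟧ + ⟦q ,_[t] p ∘_[s] r⟧ *~ (- (-1) ^+ (i * j)).
Proof.
move=> hp hq hr.
refine (phomog_ext3 (F := fun p q r => (⟦p ,_[s] q⟧ ∘_[s \+ t] r) *+ 2)
  (G := fun p q r => ⟦p ,_[s] q ∘_[t] r⟧
    + ⟦q ,_[t] p ∘_[s] r⟧ *~ (- (-1) ^+ (i * j))) _ _ _ _ _ _ _ hp hq hr);
  try by move=> ? ?; cbv beta; plin.
move=> a b c ha hb hc.
have ha' : phomog i a%:FP by apply: phomogU.
have hb' : phomog j b%:FP by apply: phomogU.
have hc' : phomog k c%:FP by apply: phomogU.
have e := map_eq2D SB (tpcsa_leibniz b hc ha).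
(* Left side of the rule: commutativity moves $c$ to the right, with subscript $-\partial-n=s+t$. *)
have eA := subst_nestr circP brkP nB sB lamS nS muW sW Slam Smu c a b.
have eA' := lprod_comm circP (@circ_sym k (i (+) j)) nS hc'
  (lprod_homog brkP sS ha' hb').
have eA'' : ⟦a%:FP ,_[s] b%:FP⟧ ∘_[\- D \- n] c%:FP
    = ⟦a%:FP ,_[s] b%:FP⟧ ∘_[s \+ t] c%:FP.
  by apply: eq_lprod => x; rewrite /n /=; zmod.
(* First bracket: $c\circ a$ is commuted while the subscripts are still $\lambda,\mu$; skew-symmetry
   then moves $b$ to the front with subscript $-\partial-(n+s)=t$. *)
have eB := map_eqMz SB (lprod_inner b%:FP circP brkP (@circ_sym k i) lamW muW
  hc' ha').
have eB' := subst_nestl brkP circP nB sB lmS nsS muW sW Slm Smu a c b.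
have eB'' := lprod_comm brkP (@brk_sym (i (+) k) j) nsS
  (lprod_homog circP sS ha' hc') hb'.
have eB3 : ⟦b%:FP ,_[\- D \- (n \+ s)] a%:FP ∘_[s] c%:FP⟧
    = ⟦b%:FP ,_[t] a%:FP ∘_[s] c%:FP⟧.
  by apply: eq_lprod => x; rewrite /n /=; zmod.
have muB : diffmorph (fun x => subst n s ⟦a%:FP ,_[mu] x⟧).
  move=> x y; have -> := lprodBr brkP a%:FP (proj1 (subscript_plinear muS)) x y.
  by rewrite SB.
(* Second bracket: $c\circ_\lambda b$ is commuted before the substitution, so that [subst_inner]
   applies. *)
have eC := map_eqMz muB (circ_sym hc hb).
have hA := etrans eA (etrans eA' (eqM _ eA'')).
have hB := etrans eB (eqM _ (etrans eB' (etrans eB'' (eqM _ eB3)))).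
have hC := etrans eC (eqM _ (subst_inner a b c)).
linear_by (e * (-1) ^+ (k * (i (+) j)) + hA * (- 2 * (-1) ^+ (k * (i (+) j)))
  + hB * (-1) ^+ (k * (i (+) j))
  + hC * ((-1) ^+ (k * (i (+) j)) * (-1) ^+ (k * i)))%EQ.
Qed.

End LastWeight.

Lemma flipC i j s s' p q : subscript s -> s' =1 \- D \- s ->
  phomog i p -> phomog j q -> p ∘_[s] q = (q ∘_[s'] p) *~ (-1) ^+ (i * j).
Proof.
move=> sS e hp hq; apply: etrans (lprod_comm circP (@circ_sym i j) sS hp hq) _.
by apply: eqM; apply: eq_lprod => x; rewrite e.
Qed.

Lemma flipB i j s s' p q : subscript s -> s' =1 \- D \- s ->
  phomog i p -> phomog j q -> ⟦p ,_[s] q⟧ = ⟦q ,_[s'] p⟧ *~ (- (-1) ^+ (i * j)).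
Proof.
move=> sS e hp hq; apply: etrans (lprod_comm brkP (@brk_sym i j) sS hp hq) _.
by apply: eqM; apply: eq_lprod => x; rewrite e.
Qed.

(** The coefficients lie in a vector space over a field of characteristic zero. *)
Lemma fpoly_inj2 p q : p *+ 2 = q *+ 2 -> p = q.
Proof.
move=> e; apply/malgP => k; apply: subr0_eq.
have /eqP : ((2%:R : R[i]) *: (p@_k - q@_k)) = 0.
  by rewrite scaler_nat mulrnBl -!mcoeffMn e subrr.
by rewrite scaler_eq0 Num.Theory.pnatr_eq0 => /eqP.
Qed.

Lemma tpcsa_laws :
  weighted_laws (@phomog R L) (@weight R L) (lprod circ) (lprod brk).
Proof.
have wB s : weight s -> diffmorph s by case=> -[].
split.
- exact: weightD.
- by move=> *; apply: eq_lprod.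
- by move=> *; apply: eq_lprod.
- by move=> s q /wB sB; exact: (lprodBl circP).
- by move=> s q /wB sB; exact: (lprodBr circP).
- by move=> s q /wB sB; exact: (lprodBl brkP).
- by move=> s q /wB sB; exact: (lprodBr brkP).
- by move=> s i j p q /weight_subscript sS; exact: (lprod_homog circP sS).
- by move=> s i j p q /weight_subscript sS; exact: (lprod_homog brkP sS).
- by move=> s t i j p q r; exact: (lprod_inner r circP circP (@circ_sym i j)).
- by move=> s t i j p q r; exact: (lprod_inner r circP brkP (@circ_sym i j)).
- by move=> *; apply: assoc; eassumption.
- by move=> *; apply: jacobi_weight; eassumption.
- by move=> *; apply: leibniz_weight; eassumption.
- by move=> *; apply: leibniz_last; eassumption.
- exact: fpoly_inj2.
Qed.

End ConformalLaws.

(** * From the weighted identities to the seven stated forms *)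

Theorem theorem3p6 (R : realType) (L : TPCSA R)
    (px py pz ph pu pv : bool) (x y z h u v : L)
    (hx : x \in homog L px) (hy : y \in homog L py) (hz : z \in homog L pz)
    (hh : h \in homog L ph) (hu : u \in homog L pu) (hv : v \in homog L pv) :
  (* (1) *)
  ( (x%:FP ∘_[lam] ⟦y%:FP ,_[mu] z%:FP⟧) *~ (-1) ^+ (px * pz)
  + (y%:FP ∘_[mu] ⟦z%:FP ,_[\- D \- lam] x%:FP⟧) *~ (-1) ^+ (px * py)
  + (z%:FP ∘_[\- D \- lam \- mu] ⟦x%:FP ,_[lam] y%:FP⟧) *~ (-1) ^+ (py * pz)
  = 0 )
  /\
  (* (2) *)
  ( (⟦x%:FP ,_[lam] y%:FP⟧ ∘_[mu] z%:FP) *~ (-1) ^+ (px * pz)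
  + (⟦y%:FP ,_[mu \- lam] z%:FP⟧ ∘_[\- D \- lam] x%:FP) *~ (-1) ^+ (px * py)
  + (⟦z%:FP ,_[\- D \- lam] x%:FP⟧ ∘_[\- D \- mu \+ lam] y%:FP)
      *~ (-1) ^+ (py * pz)
  = 0 )
  /\
  (* (3) *)
  ( ⟦h%:FP ∘_[lam] ⟦x%:FP ,_[gam] y%:FP⟧ ,_[lam \+ mu] z%:FP⟧
      *~ (-1) ^+ (px * pz)
  + ⟦h%:FP ∘_[lam] ⟦y%:FP ,_[mu \- gam] z%:FP⟧ ,_[\- D \- gam] x%:FP⟧
      *~ (-1) ^+ (px * py)
  + ⟦h%:FP ∘_[lam] ⟦z%:FP ,_[\- D \- gam] x%:FP⟧ ,_[\- D \- mu \+ gam] y%:FP⟧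
      *~ (-1) ^+ (py * pz)
  = 0 )
  /\
  (* (4) *)
  ( ⟦h%:FP ∘_[lam] x%:FP ,_[lam \+ gam] ⟦y%:FP ,_[mu \- gam] z%:FP⟧⟧
      *~ (-1) ^+ (px * pz)
  + ⟦h%:FP ∘_[lam] y%:FP ,_[lam \+ mu \- gam] ⟦z%:FP ,_[\- D \- gam] x%:FP⟧⟧
      *~ (-1) ^+ (px * py)
  + ⟦h%:FP ∘_[lam] z%:FP ,_[\- D \- mu] ⟦x%:FP ,_[gam] y%:FP⟧⟧
      *~ (-1) ^+ (py * pz)
  = 0 )
  /\
  (* (5) *)
  ( (⟦h%:FP ,_[lam] x%:FP⟧ ∘_[lam \+ gam] ⟦y%:FP ,_[mu \- gam] z%:FP⟧)
      *~ (-1) ^+ (px * pz)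
  + (⟦h%:FP ,_[lam] y%:FP⟧ ∘_[lam \+ mu \- gam] ⟦z%:FP ,_[\- D \- gam] x%:FP⟧)
      *~ (-1) ^+ (px * py)
  + (⟦h%:FP ,_[lam] z%:FP⟧ ∘_[\- D \- mu] ⟦x%:FP ,_[gam] y%:FP⟧)
      *~ (-1) ^+ (py * pz)
  = 0 )
  /\
  (* (6) *)
  ( ⟦u%:FP ∘_[lam] x%:FP ,_[mu] v%:FP ∘_[gam] y%:FP⟧ *~ (-1) ^+ (pv * px)
  + ⟦v%:FP ∘_[gam] x%:FP ,_[gam \+ mu \- lam] u%:FP ∘_[lam] y%:FP⟧
      *~ (-1) ^+ (pu * (px + pv))
  = ((u%:FP ∘_[lam] v%:FP) ∘_[lam \+ gam] ⟦x%:FP ,_[mu \- lam] y%:FP⟧) *+ 2 )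
  /\
  (* (7) *)
  ( (x%:FP ∘_[mu \- lam] ⟦u%:FP ,_[lam] v%:FP ∘_[gam] y%:FP⟧)
      *~ (-1) ^+ (pv * px)
  + (⟦v%:FP ∘_[gam] x%:FP ,_[gam \+ mu \- lam] u%:FP⟧ ∘_[gam \+ mu] y%:FP)
      *~ (-1) ^+ (pu * pv)
  - ((u%:FP ∘_[lam] v%:FP) ∘_[lam \+ gam] ⟦x%:FP ,_[mu \- lam] y%:FP⟧)
      *~ (-1) ^+ (pu * px)
  = 0 ).
Proof.
have hX : phomog px x%:FP by apply: phomogU.
have hY : phomog py y%:FP by apply: phomogU.
have hZ : phomog pz z%:FP by apply: phomogU.
have hH : phomog ph h%:FP by apply: phomogU.
have hU : phomog pu u%:FP by apply: phomogU.
have hV : phomog pv v%:FP by apply: phomogU.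
have lW := weight_lam L; have mW := weight_mu L; have gW := weight_gam L.
have lS := weight_subscript lW; have gS := weight_subscript gW.
have lmS := weight_subscript (weightD lW mW).
have mlW := weightB mW lW; have mlS := weight_subscript mlW.
have mgW := weightB mW gW; have mgS := weight_subscript mgW.
have mS := weight_subscript mW.
have law := tpcsa_laws L.
have CH s (sS : subscript s) i j p q := @lprod_homog R L _ (circP L) s i j p q sS.
have BH s (sS : subscript s) i j p q := @lprod_homog R L _ (brkP L) s i j p q sS.
(* These turn the weighted bracket of $x$ and $z$ into the cyclic form, with $z$ first and a
   subscript involving $\partial$. *)
have lB := flipB lS (frefl _) hX hZ; have gB := flipB gS (frefl _) hX hZ.
refine (conj _ (conj _ (conj _ (conj _ (conj _ (conj _ _)))))).
(* Here $x,y$ have weights $\lambda,\mu$, and $z$ takes the remaining $-\partial-\lambda-\mu$ once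
   moved to the front. *)
- have e := cyclic_CB law lW mW hX hY hZ.
  have c2 := map_eqMz (wl_Cr law y%:FP mW) lB.
  have r3 : \- D \- lam \- mu =1 \- D \- (@lam L \+ mu).
    by move=> p /=; zmod.
  have c3 := flipC lmS r3 (BH _ lS _ _ _ _ hX hY) hZ.
  linear_by (e * (-1) ^+ (px * pz)
    + c2 * ((-1) ^+ (px * pz) * (-1) ^+ (px * py))
    + c3 * - (-1) ^+ (px * pz))%EQ.
(* The weight of $y$ is now $\mu-\lambda$, so that $[x_\lambda y]$ has total weight $\mu$. *)
- have e := cyclic_CB law lW mlW hX hY hZ.
  have r1 : lam \+ (mu \- lam) =1 @mu L by move=> p /=; zmod.
  have c1 := wl_extC law ⟦x%:FP ,_[lam] y%:FP⟧ z%:FP r1.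
  have c2 := flipC lS (frefl _) hX (BH _ mlS _ _ _ _ hY hZ).
  have r3 : \- D \- mu \+ lam =1 \- D \- (@mu L \- lam).
    by move=> p /=; zmod.
  have nS := subscript_ssub lS.
  have c3 := flipC mlS r3 hY (BH _ nS _ _ _ _ hZ hX).
  have c3' := map_eqMz (wl_Cr law y%:FP mlW) lB.
  linear_by (e * (-1) ^+ (px * pz) + c1 * - (-1) ^+ (px * pz)
    + c2 * - (-1) ^+ (px * pz)
    + c3' * ((-1) ^+ (px * pz) * (-1) ^+ (px * py))
    + c3 * - (-1) ^+ (px * py))%EQ.
(* The weights of $h,x,y$ are $\lambda,\gamma,\mu-\gamma$; skew-symmetry moves $x$ and $y$ to the
   end of the outer brackets. *)
- have e := cyclic_BCB law lW gW mgW hH hX hY hZ.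
  have r1 : lam \+ (gam \+ (mu \- gam)) =1 @lam L \+ mu.
    by move=> p /=; zmod.
  have c1 := wl_extB law (h%:FP ∘_[lam] ⟦x%:FP ,_[gam] y%:FP⟧) z%:FP r1.
  have c2 := flipB gS (frefl _) hX (CH _ lS _ _ _ _ hH (BH _ mgS _ _ _ _ hY hZ)).
  have r3 : \- D \- mu \+ gam =1 \- D \- (@mu L \- gam).
    by move=> p /=; zmod.
  have nS := subscript_ssub gS.
  have c3 := flipB mgS r3 hY (CH _ lS _ _ _ _ hH (BH _ nS _ _ _ _ hZ hX)).
  have c3' := map_eqMz (wl_Br law y%:FP mgW)
    (map_eqMz (wl_Cr law h%:FP lW) gB).
  linear_by (e * (-1) ^+ (px * pz) + c1 * - (-1) ^+ (px * pz)
    + c2 * ((-1) ^+ (px * pz) * (-1) ^+ (ph * px))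
    + c3' * - ((-1) ^+ (px * pz) * (-1) ^+ (ph * py) * (-1) ^+ (px * py))
    + c3 * ((-1) ^+ (ph * py) * (-1) ^+ (px * py)))%EQ.
(* Same weights; $[x_\gamma y]$ has weight $\mu$, and exchanging it with $h\circ z$ gives the
   subscript $-\partial-\mu$. *)
- have e := cyclic_BC_B law lW gW mgW hH hX hY hZ.
  have r2 : lam \+ (mu \- gam) =1 @lam L \+ mu \- gam.
    by move=> p /=; zmod.
  have c2 := wl_extB law (h%:FP ∘_[lam] y%:FP) ⟦x%:FP ,_[gam] z%:FP⟧ r2.
  have c2' := map_eqMz (wl_Br law (h%:FP ∘_[lam] y%:FP)
    (weightB (weightD lW mW) gW)) gB.
  have r3 : gam \+ (mu \- gam) =1 @mu L by move=> p /=; zmod.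
  have c3 := wl_extB law ⟦x%:FP ,_[gam] y%:FP⟧ (h%:FP ∘_[lam] z%:FP) r3.
  have c3' := flipB mS (frefl _) (BH _ gS _ _ _ _ hX hY)
    (CH _ lS _ _ _ _ hH hZ).
  linear_by (e * (-1) ^+ (px * pz)
    + (c2 + c2') * ((-1) ^+ (px * pz) * (-1) ^+ (px * py))
    + (c3 + c3') * ((-1) ^+ (px * pz) * (-1) ^+ (ph * px) * (-1) ^+ (ph * py)))%EQ.
- have e := cyclic_CBB law lW gW mgW hH hX hY hZ.
  have r2 : lam \+ (mu \- gam) =1 @lam L \+ mu \- gam.
    by move=> p /=; zmod.
  have c2 := wl_extC law ⟦h%:FP ,_[lam] y%:FP⟧ ⟦x%:FP ,_[gam] z%:FP⟧ r2.
  have c2' := map_eqMz (wl_Cr law ⟦h%:FP ,_[lam] y%:FP⟧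
    (weightB (weightD lW mW) gW)) gB.
  have r3 : gam \+ (mu \- gam) =1 @mu L by move=> p /=; zmod.
  have c3 := wl_extC law ⟦x%:FP ,_[gam] y%:FP⟧ ⟦h%:FP ,_[lam] z%:FP⟧ r3.
  have c3' := flipC mS (frefl _) (BH _ gS _ _ _ _ hX hY)
    (BH _ lS _ _ _ _ hH hZ).
  linear_by (e * (-1) ^+ (px * pz)
    + (c2 + c2') * ((-1) ^+ (px * pz) * (-1) ^+ (px * py))
    + (c3 + c3') * - ((-1) ^+ (px * pz) * (-1) ^+ (ph * px) * (-1) ^+ (ph * py)))%EQ.
(* The weights of $u,v,x$ are $\lambda,\gamma,\mu-\lambda$, so $u\circ x$ has weight $\mu$ and
   $v\circ x$ has weight $\gamma+\mu-\lambda$. *)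
- have e := B_CC law lW gW mlW hU hV hX hY.
  have r1 : lam \+ (mu \- lam) =1 @mu L by move=> p /=; zmod.
  have r2 : gam \+ (mu \- lam) =1 @gam L \+ mu \- lam by move=> p /=; zmod.
  have c1 := wl_extB law (u%:FP ∘_[lam] x%:FP) (v%:FP ∘_[gam] y%:FP) r1.
  have c2 := wl_extB law (v%:FP ∘_[gam] x%:FP) (u%:FP ∘_[lam] y%:FP) r2.
  linear_by (e + c1 * - (-1) ^+ (pv * px)
    + c2 * - (-1) ^+ (pu * (px + pv)))%EQ.
- have e := C_B_C law lW gW mlW hU hV hX hY.
  have r1 : gam \+ (mu \- lam) =1 @gam L \+ mu \- lam by move=> p /=; zmod.
  have r2 : gam \+ (mu \- lam) \+ lam =1 @gam L \+ mu by move=> p /=; zmod.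
  have gmW := weightD gW mW.
  have c1 := wl_extB law (v%:FP ∘_[gam] x%:FP) u%:FP r1.
  have c2 := wl_extC law ⟦v%:FP ∘_[gam] x%:FP ,_[gam \+ (mu \- lam)] u%:FP⟧
    y%:FP r2.
  have c1' := congr1 ((lprod (@tpcsa_circ R L) (gam \+ mu))^~ y%:FP) c1.
  linear_by (e + (c2 + c1') * - (-1) ^+ (pu * pv))%EQ.
Qed.
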